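(* Let $\zeta \in \mathbb{C}$ be a primitive 8th root of unity, let $x_0,\ldots,x_3$ and $y_0,\ldots,y_3$ be the homogeneous coordinates of the first and second factor of $\mathbb{P}^3\times\mathbb{P}^3$, and let $\pi_1,\pi_2\colon \mathbb{P}^3\times\mathbb{P}^3 \to \mathbb{P}^3$ be the first and second projection. Consider the polynomials of bi-degree $(1,1)$ \begin{align*} Q_0 ={}& \zeta^{3} x_{0} y_{2} + \zeta x_{3} y_{0} + x_{1} y_{0} - x_{2} y_{2}, \\ Q_1 ={}& \zeta^{3} x_{3} y_{1} - \zeta^{3} x_{0} y_{3} + \zeta^{2} x_{2} y_{3} + x_{1} y_{1}, \\ Q_2 ={}& -(\zeta^{2} - \zeta - 1) x_{2} y_{0} - (\zeta^{2} + 2 \zeta - 1) x_{0} y_{1} - (\zeta^{2} - 2) x_{1} y_{1} \\ & + (\zeta^{2} - \zeta - 1) x_{2} y_{1} + (\zeta^{2} - 1) x_{0} y_{2} - (\zeta^{3} + \zeta - 1) x_{1} y_{2} \\ & - (\zeta^{3} + \zeta + 2) x_{3} y_{2} - (\zeta^{3} + \zeta) x_{0} y_{3} - (\zeta^{3} + \zeta - 1) x_{1} y_{3} \\ & + (\zeta^{2} - \zeta + 1) x_{2} y_{3} + \zeta x_{2} y_{2} + x_{1} y_{0}, \\ Q_3 ={}& 6\zeta^{3} x_{3} y_{3} - (4 \zeta^{3} + 3 \zeta^{2} - 2 \zeta + 1) x_{1} y_{0} - 3 (\zeta^{3} + \zeta) x_{2} y_{0} \\ & + (2 \zeta^{3}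 + \zeta^{2} + 1) x_{1} y_{1} - 3 (\zeta^{3} + \zeta) x_{2} y_{1} + 2 (\zeta^{2} + \zeta - 1) x_{0} y_{2} \\ & + 3 (\zeta^{2} + 1) x_{1} y_{2} + (3 \zeta^{3} + 2 \zeta^{2} - \zeta - 2) x_{2} y_{2} - 2 (\zeta^{3} + \zeta + 1) x_{0} y_{3} \\ & - 3 (\zeta^{2} + 1) x_{1} y_{3} + (\zeta^{3} + \zeta - 2) x_{2} y_{3} + 6 x_{0} y_{0}. \end{align*} Then the four hypersurfaces given by $Q_i = 0$ ($i=0,\ldots,3$) define a smooth complete intersection $S$ in $\mathbb{P}^3\times \mathbb{P}^3$ such that the restrictions of $\pi_1$ and $\pi_2$ to $S$ are isomorphisms onto $X_{48}$ and $X_{56}$, respectively.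
   Context: All varieties are defined over $\mathbb{C}$. $X_{48} \subset \mathbb{P}^3$ is the Fermat quartic surface $x_0^4+x_1^4+x_2^4+x_3^4=0$. By the classification of Degtyarev, Itenberg and Sertöz, there are, up to projective equivalence, exactly two smooth quartic surfaces in $\mathbb{P}^3$ which contain exactly $56$ lines and are isomorphic, as abstract K3 surfaces, to the Fermat quartic surface (equivalently, whose transcendental lattice has Gram matrix $\begin{pmatrix} 8&0\\0&8\end{pmatrix}$); they are complex conjugate to each other. $X_{56}$ denotes a surface in one of these two projective equivalence classes (which one is not specified, and its coordinates are those determined by $S$). *)

(* Defs.v *)
From mathcomp Require Export all_boot all_order all_algebra.
From mathcomp Require Export classical_sets cardinality reals.
From mathcomp Require Export complex.
From mathcomp Require Export mpoly.

Set Implicit Arguments.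
Unset Strict Implicit.
Unset Printing Implicit Defensive.

Import GRing.Theory.
Local Open Scope ring_scope.
Local Open Scope classical_set_scope.
Local Open Scope card_scope.

(* A space of points with (multi)homogeneous coordinates. [coords p] is one
   choice of homogeneous coordinates of the point [p]; below it is only used in
   ways that do not depend on that choice: vanishing of forms, quotients of two
   forms of equal multidegree, and the rank of the Jacobian matrix of a family
   of forms at a common zero. The zero polynomial is a form of every
   multidegree. *)
Record multiproj (C : fieldType) := Multiproj {
  point :> Type;
  nvar : nat;
  coords : point -> 'I_nvar -> C;
  mdegree : Type;
  form : mdegree -> set {mpoly C[nvar]} }.

Section ProjectiveSpaces.
Variable C : fieldType.

(* The points of P^n are the lines through the origin of C^(n+1). *)
Definition ppoint (n : nat) : Type :=
  {L : {vspace 'rV[C]_n.+1} | \dim L == 1%N}.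

Definition pcoords (n : nat) (p : ppoint n) (i : 'I_n.+1) : C :=
  vpick (val p) 0 i.

Definition projSpace (n : nat) : multiproj C :=
  {| point := ppoint n;
     nvar := n.+1;
     coords := @pcoords n;
     mdegree := nat;
     form := fun d => [set f : {mpoly C[n.+1]} | f \is d.-homog] |}.

Definition bihomog (n m : nat) (de : nat * nat)
    (f : {mpoly C[n.+1 + m.+1]}) : Prop :=
  forall mon, mon \in msupp f ->
    (\sum_(i < n.+1) mon (lshift m.+1 i))%N = de.1 /\
    (\sum_(j < m.+1) mon (rshift n.+1 j))%N = de.2.

(* The coordinates of the first factor come before those of the second one. *)
Definition projProd (n m : nat) : multiproj C :=
  {| point := (ppoint n * ppoint m)%type;
     nvar := n.+1 + m.+1;
     coords := fun p i =>
       match fintype.split i with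
       | inl j => pcoords p.1 j
       | inr j => pcoords p.2 j
       end;
     mdegree := (nat * nat)%type;
     form := fun de => [set f | bihomog de f] |}.

End ProjectiveSpaces.

Section Varieties.
Variable C : fieldType.

Definition zlocus (A : multiproj C) (E : set {mpoly C[nvar A]}) : set A :=
  [set p | forall f, E f -> f.@[coords p] = 0].

(* Open subsets, for the Zariski topology, of a subset X of A. *)
Definition zopen (A : multiproj C) (X U : set A) : Prop :=
  exists E : set {mpoly C[nvar A]},
    (forall f, E f -> exists d, form d f) /\ U = X `\` zlocus E.

(* Regular functions on an open subset U of X; only the values of f on U
   matter. *)
Definition regular (A : multiproj C) (X U : set A) (f : A -> C) : Prop :=
  forall p, U p -> exists W : set A,
    [/\ zopen X W, W p, W `<=` U &
        exists (d : mdegree A) (g h : {mpoly C[nvar A]}),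
          [/\ form d g, form d h &
              forall q, W q ->
                h.@[coords q] != 0 /\ f q = g.@[coords q] / h.@[coords q]]].

(* Morphisms X -> Y; only the values of phi on X matter. *)
Definition morphism (A B : multiproj C) (X : set A) (Y : set B)
    (phi : A -> B) : Prop :=
  [/\ forall p, X p -> Y (phi p),
      forall V, zopen Y V -> zopen X (X `&` phi @^-1` V) &
      forall V f, zopen Y V -> regular Y V f ->
        regular X (X `&` phi @^-1` V) (f \o phi)].

Definition isomorphism (A B : multiproj C) (X : set A) (Y : set B)
    (phi : A -> B) : Prop :=
  morphism X Y phi /\
  exists psi : B -> A,
    [/\ morphism Y X psi,
        forall p, X p -> psi (phi p) = p &
        forall q, Y q -> phi (psi q) = q].

Definition isomorphic (A B : multiproj C) (X : set A) (Y : set B) : Prop :=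
  exists phi : A -> B, isomorphism X Y phi.

(* The equations of fs define a nonempty subscheme of codimension r which is
   smooth, by the Jacobian criterion: at every common zero, the differentials
   of the r equations are linearly independent. By Euler's relations the
   Jacobian matrix with respect to all homogeneous coordinates has, at such a
   point, the same rank as the one computed in an affine chart. *)
Definition smooth_complete_intersection (A : multiproj C) (r : nat)
    (fs : r.-tuple {mpoly C[nvar A]}) : Prop :=
  [/\ forall i, exists d, form d (tnth fs i),
      @zlocus A [set` fs] !=set0 &
      forall p : A, @zlocus A [set` fs] p ->
        \rank (\matrix_(i < r, j < nvar A)
                 ((tnth fs i)^`M(j)).@[coords p]) = r].

End Varieties.

Section Surfaces.
Variable C : fieldType.

Definition surface (F : {mpoly C[4]}) : set (projSpace C 3) :=
  @zlocus C (projSpace C 3) [set F].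

Definition smooth_quartic (F : {mpoly C[4]}) : Prop :=
  F \is 4.-homog /\
  @smooth_complete_intersection C (projSpace C 3) 1 [tuple F].

(* Lines of P^3 are the planes through the origin of C^4. *)
Definition lines_in (X : set (projSpace C 3)) : set {vspace 'rV[C]_4} :=
  [set L | \dim L = 2%N /\
           forall p : projSpace C 3, (val p <= L)%VS -> X p].

Definition fermat_quartic : {mpoly C[4]} := \sum_(i < 4) 'X_i ^+ 4.

Definition X48 : set (projSpace C 3) := surface fermat_quartic.

(* F is an equation of a surface in one of the two (complex conjugate)
   projective equivalence classes of smooth quartics which contain exactly 56
   lines and are isomorphic to the Fermat quartic. *)
Definition is_X56 (F : {mpoly C[4]}) : Prop :=
  [/\ smooth_quartic F,
      lines_in (surface F) #= `I_56 &
      isomorphic (surface F) X48].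

End Surfaces.

Arguments X48 : clear implicits.

Section Equations.
Variables (C : fieldType) (z : C).

Local Notation "'x_ k" := ('X_(lshift 4 (@Ordinal 4 k isT)))
  (at level 8, k at level 0, format "''x_' k").
Local Notation "'y_ k" := ('X_(rshift 4 (@Ordinal 4 k isT)))
  (at level 8, k at level 0, format "''y_' k").

Definition Q0 : {mpoly C[4 + 4]} :=
  z ^+ 3 *: ('x_0 * 'y_2) + z *: ('x_3 * 'y_0) + 'x_1 * 'y_0 - 'x_2 * 'y_2.

Definition Q1 : {mpoly C[4 + 4]} :=
  z ^+ 3 *: ('x_3 * 'y_1) - z ^+ 3 *: ('x_0 * 'y_3)
  + z ^+ 2 *: ('x_2 * 'y_3) + 'x_1 * 'y_1.

Definition Q2 : {mpoly C[4 + 4]} :=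
  - (z ^+ 2 - z - 1) *: ('x_2 * 'y_0)
  - (z ^+ 2 + 2 * z - 1) *: ('x_0 * 'y_1)
  - (z ^+ 2 - 2) *: ('x_1 * 'y_1)
  + (z ^+ 2 - z - 1) *: ('x_2 * 'y_1)
  + (z ^+ 2 - 1) *: ('x_0 * 'y_2)
  - (z ^+ 3 + z - 1) *: ('x_1 * 'y_2)
  - (z ^+ 3 + z + 2) *: ('x_3 * 'y_2)
  - (z ^+ 3 + z) *: ('x_0 * 'y_3)
  - (z ^+ 3 + z - 1) *: ('x_1 * 'y_3)
  + (z ^+ 2 - z + 1) *: ('x_2 * 'y_3)
  + z *: ('x_2 * 'y_2)
  + 'x_1 * 'y_0.

Definition Q3 : {mpoly C[4 + 4]} :=
  (6 * z ^+ 3) *: ('x_3 * 'y_3)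
  - (4 * z ^+ 3 + 3 * z ^+ 2 - 2 * z + 1) *: ('x_1 * 'y_0)
  - (3 * (z ^+ 3 + z)) *: ('x_2 * 'y_0)
  + (2 * z ^+ 3 + z ^+ 2 + 1) *: ('x_1 * 'y_1)
  - (3 * (z ^+ 3 + z)) *: ('x_2 * 'y_1)
  + (2 * (z ^+ 2 + z - 1)) *: ('x_0 * 'y_2)
  + (3 * (z ^+ 2 + 1)) *: ('x_1 * 'y_2)
  + (3 * z ^+ 3 + 2 * z ^+ 2 - z - 2) *: ('x_2 * 'y_2)
  - (2 * (z ^+ 3 + z + 1)) *: ('x_0 * 'y_3)
  - (3 * (z ^+ 2 + 1)) *: ('x_1 * 'y_3)
  + (z ^+ 3 + z - 2) *: ('x_2 * 'y_3)
  + 6 *: ('x_0 * 'y_0).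

Definition Qs : 4.-tuple {mpoly C[4 + 4]} := [tuple Q0; Q1; Q2; Q3].

Definition Sci : set (projProd C 3 3) := @zlocus C (projProd C 3 3) [set` Qs].

End Equations.

(* Main.v *)
From Stdlib Require Import BinInt BinNat Pnat Nnat Ring_polynom Ring_theory InitialRing.
From HB Require Import structures.
Require Import Defs.
From mathcomp Require Import ssrZ ring boolp.

Set Implicit Arguments.
Unset Strict Implicit.
Unset Printing Implicit Defensive.
Import GRing.Theory Num.Theory.
Local Open Scope ring_scope.
Local Open Scope classical_set_scope.
Local Open Scope card_scope.

(** The four bilinear forms can be read as a linear system A(x) y = 0 in y, or
    as a linear system B(y) x = 0 in x, where A and B are 4 x 4 matrices of
    linear forms.  A computation gives, for one constant c <> 0,

      det A(x) = c (x0^4 + x1^4 + x2^4 + x3^4)   and   det B(y) = c F(y),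

    so the projections of S are contained in the Fermat quartic and in F = 0.
    Both quartics are smooth.  By Jacobi's formula ([mderiv_det]) the gradient
    of a determinant is a combination of cofactors, hence the adjugate of A(x)
    is nonzero at every point of the Fermat quartic: A(x) has corank exactly
    one, and its kernel is a single point y, given by any nonzero column of
    the adjugate.  These columns are forms in x, so x |-> (x, y) is a morphism
    inverse to the first projection ([determinantal_isomorphism]).  A linear
    relation with coefficients lam between the differentials of the four forms
    at (x, y) makes adj A(x) proportional to the product of the column y and
    the row lam, and then Jacobi's formula makes the gradient of det A vanish
    at x; thus S is a smooth complete intersection
    ([determinantal_smooth_ci]).  Exchanging the factors gives the second
    projection.

    The quartic F has a short form.  With i = z^2, b = z + z^3 - 1 and

      u = y2 + b y1,  v = y3 + b y0,  s = y1 - b y2,  t = y0 - b y3,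

    it is F = l0 l1 l2 l3 + m0 m1 m2 m3, where

      l0 = y2,  l1 = y3,  l2 = u + i v,  l3 = u - i v,
      m0 = y0,  m1 = y1,  m2 = s + i t,  m3 = s - i t.

    It is smooth because 4608 y0^9 lies in its Jacobian ideal
    ([jacobian_certificate]) and because a group of symmetries of F permutes
    the coordinates transitively up to sign.

    The lines of F = 0 are found as follows ([line_classification]).  A line
    contained in one of the eight planes l_i = 0, m_j = 0 is one of the
    sixteen lines l_i = m_j = 0.  Any other line meets the plane m0 = 0 in a
    point A, where the product of the l's vanishes, so l_i(A) = 0 for some i;
    it meets m1 = 0 in a point B with l_j(B) = 0.  If i = j the line would lie
    in the plane l_i = 0, which is also the tangent plane at A when A = B.  If
    i <> j, the line has equations m0 = b' l_i, m1 = a' l_j with nonzero a'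
    and b', and the restriction of F to it is a product of two coordinates and
    a binary quadratic form whose three coefficients are polynomials in a' and
    b'.  For each of the twelve pairs (i, j) an elimination certificate leaves
    finitely many (a', b'), and all of these do give lines, 40 in total.
    Hence there are 16 + 40 = 56 lines.

    All identities have coefficients in Z[z] with z^4 = -1; they are checked by
    computing with quadruples of integers and transported to the field by
    [same_polyP]. *)

(** * Points of projective space *)

Section Points.
Variables (C : fieldType) (n : nat).
Implicit Types (p q : ppoint C n) (v w : 'rV[C]_n.+1).

Definition pvec p : 'rV[C]_n.+1 := vpick (val p).

Lemma pvec_neq0 p : pvec p != 0.
Proof.
rewrite /pvec vpick0 -dimv_eq0; case: p => L /= /eqP -> //.
Qed.

Lemma val_ppoint p : val p = <[pvec p]>%VS.
Proof.
apply/eqP; rewrite eq_sym eqEdim -memvE memv_pick dim_vline pvec_neq0.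
by case: p => L /= /eqP ->.
Qed.

Lemma ppoint_eq p q (k : C) : pvec p = k *: pvec q -> p = q.
Proof.
move=> e; apply/val_inj; rewrite !val_ppoint; apply/eqP.
rewrite eqEdim !dim_vline !pvec_neq0 leqnn andbT -memvE.
by apply/vlineP; exists k.
Qed.

Lemma pt_of_key v (nz : v != 0) : \dim <[v]>%VS == 1%N.
Proof. by rewrite dim_vline nz. Qed.

Definition pt_of v (nz : v != 0) : ppoint C n := exist _ <[v]>%VS (pt_of_key nz).

Lemma pvec_pt_of v (nz : v != 0) :
  exists2 k : C, k != 0 & v = k *: pvec (pt_of nz).
Proof.
have /vlineP[k e] : v \in <[pvec (pt_of nz)]>%VS.
  by rewrite -val_ppoint /= memv_line.
exists k => //; apply/eqP => k0; case/eqP: (nz).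
by rewrite [LHS]e k0 scale0r.
Qed.

Lemma pt_of_mem v (nz : v != 0) (L : {vspace 'rV[C]_n.+1}) :
  v \in L -> (val (pt_of nz) <= L)%VS.
Proof. by rewrite /= memvE. Qed.

Lemma coordsE p : @coords C (projSpace C n) p = pvec p 0.
Proof. by []. Qed.

Lemma dhomog_scale d (f : {mpoly C[n.+1]}) (k : C) v :
  f \is d.-homog -> f.@[(k *: v) 0] = k ^+ d * f.@[v 0].
Proof.
move=> hf; rewrite !mevalE mulr_sumr !big_seq; apply: eq_bigr => m hm.
rewrite mulrCA; congr (_ * _).
under eq_bigr do rewrite mxE exprMn.
rewrite big_split /= prodrXr; congr (k ^+ _ * _).
by have := dhomog_mf hf hm; rewrite /= mdegE.
Qed.

(** The vanishing of a form may be tested on any nonzero vector of the line, in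
    place of the vector chosen by [vpick]. *)
Lemma dhomog_root d (f : {mpoly C[n.+1]}) v (nz : v != 0) :
  f \is d.-homog -> (f.@[v 0] == 0) = (f.@[pvec (pt_of nz) 0] == 0).
Proof.
move=> hf; have [k k0 {1}->] := pvec_pt_of nz.
by rewrite (dhomog_scale _ _ hf) mulf_eq0 expf_eq0 (negPf k0) andbF.
Qed.

End Points.

(** * Morphisms given by forms *)

Section Morphisms.
Variable C : fieldType.

(** A map is a morphism as soon as forms on the target can be pulled back to
    forms on the source.  One pullback need not suffice: [lift i] computes the
    composite with [phi] only up to the factor [w i], and is useful on the
    subset [U i] where this factor does not vanish; the sets [U i] have to
    cover the source.  That [w i d] and [w i d'] vanish together for all
    multidegrees lets one index [i] serve both for the equations of an open
    set and for a quotient of two forms defined on it. *)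
Lemma morphism_by_lifts (A B : multiproj C) (X : set A) (Y : set B)
    (phi : A -> B) (I : Type)
    (lift : I -> mdegree B -> {mpoly C[nvar B]} -> {mpoly C[nvar A]})
    (w : I -> mdegree B -> A -> C) (U : I -> set A) :
  (forall p, X p -> Y (phi p)) ->
  (forall i d, exists d', forall f, form d f -> form d' (lift i d f)) ->
  (forall i d f p, X p -> form d f ->
     (lift i d f).@[coords p] = w i d p * f.@[coords (phi p)]) ->
  (forall i d p, X p -> w i d p != 0 <-> U i p) ->
  (forall p, X p -> exists i, U i p) ->
  morphism X Y phi.
Proof.
move=> XY Lform Leval wU Ucov.
pose pull (J : set I) (E : set {mpoly C[nvar B]}) : set {mpoly C[nvar A]} :=
  [set g | exists i d f, [/\ J i, E f, form d f & g = lift i d f]].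
have pull_form J E g : pull J E g -> exists d, form d g.
  move=> [i [d [f [_ _ hf ->]]]]; have [d' hd'] := Lform i d.
  by exists d'; apply: hd'.
have pull_nz (J : set I) E (hE : forall f, E f -> exists d, form d f) p : X p ->
    (~ zlocus (A := A) (pull J E) p) <->
    exists2 i, J i /\ U i p & ~ zlocus (A := B) E (phi p).
  move=> Xp; split.
    move=> /existsNP[g /not_implyP[[i [d [f [Ji Ef hf ->]]]]]].
    rewrite Leval // => nz; exists i; first split=> //.
      apply/(wU i d) => //; apply/eqP => w0; apply: nz; rewrite w0 mul0r //.
    by move=> /(_ f Ef) f0; apply: nz; rewrite f0 mulr0.
  move=> [i [Ji Ui] /existsNP[f /not_implyP[Ef nz]]].
  have [d hf] := hE _ Ef.
  move=> /(_ (lift i d f)) H; have : (lift i d f).@[coords p] = 0.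
    by apply: H; exists i, d, f.
  rewrite Leval // => /eqP; rewrite mulf_eq0 => /orP[|/eqP//].
  by have /(wU i d p Xp) /negPf -> := Ui.
split=> //.
- move=> V [E [hE ->]]; exists (pull setT E); split; first exact: pull_form.
  rewrite eqEsubset; split=> p.
    move=> [Xp [_ nz]]; split=> //; apply/pull_nz => //.
    by have [i Ui] := Ucov p Xp; exists i.
  move=> [Xp /pull_nz[]// i [_ Ui] nz]; split=> //; split=> //; exact: XY.
- move=> V f _ regf p [Xp Vp].
  have [W [[E [hE WE]] Wp WV [d [g [h [hg hh gh]]]]]] := regf _ Vp.
  have [i Ui] := Ucov p Xp.
  have [d' hd'] := Lform i d.
  exists (X `\` zlocus (A := A) (pull [set i] E)); split.
  + exists (pull [set i] E); split=> //; exact: pull_form.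
  + split=> //; apply/pull_nz => //; exists i => //.
    by move: Wp; rewrite WE => -[].
  + move=> q [Xq /pull_nz[]// j _ nz]; split=> //; apply: WV; rewrite WE.
    by split=> //; exact: XY.
  (* the factor w i d cancels in the quotient of the two pullbacks *)
  + exists d', (lift i d g), (lift i d h); split; [exact: hd' | exact: hd' |].
    move=> q [Xq /pull_nz[]// j [-> Uq] nz].
    have [|h0 fgh] := gh (phi q); first by rewrite WE; split=> //; exact: XY.
    have w0 : w i d q != 0 by apply/wU.
    rewrite !Leval // mulf_neq0 //; split=> //=.
    by rewrite fgh invfM mulrACA divff // mul1r.
Qed.

Lemma morphism_comp (A B D : multiproj C) (X : set A) (Y : set B) (Z : set D)
    (f : A -> B) (g : B -> D) :
  morphism X Y f -> morphism Y Z g -> morphism X Z (g \o f).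
Proof.
move=> [fXY fo fr] [gYZ go gr].
have pre V : X `&` (g \o f) @^-1` V = X `&` f @^-1` (Y `&` g @^-1` V).
  by rewrite eqEsubset; split=> p [Xp] => [Vp|[_ Vp]]; split=> //; split=> //; exact: fXY.
split=> [p Xp|V oV|V h oV rh]; first by apply/gYZ/fXY.
  by rewrite pre; apply/fo/go.
rewrite pre (_ : h \o (g \o f) = (h \o g) \o f) //.
by apply: fr; [exact: go | exact: gr].
Qed.

Lemma isomorphism_comp (A B D : multiproj C) (X : set A) (Y : set B) (Z : set D)
    (f : A -> B) (g : B -> D) :
  isomorphism X Y f -> isomorphism Y Z g -> isomorphism X Z (g \o f).
Proof.
move=> [mf [f' [mf' ff' f'f]]] [mg [g' [mg' gg' g'g]]].
have [fXY _ _] := mf; have [g'ZY _ _] := mg'.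
split; first exact: morphism_comp mf mg.
exists (f' \o g'); split=> [|p Xp|q Zq] /=; first exact: morphism_comp mg' mf'.
  by rewrite gg' ?ff' //; exact: fXY.
by rewrite f'f ?g'g //; exact: g'ZY.
Qed.

Lemma isomorphism_isomorphic (A B D : multiproj C)
    (X : set A) (Y : set B) (Z : set D) (f : A -> B) (g : A -> D) :
  isomorphism X Y f -> isomorphism X Z g -> isomorphic Y Z.
Proof.
move=> [mf [f' [mf' ff' f'f]]] isog.
exists (g \o f'); apply: isomorphism_comp isog.
by split=> //; exists f.
Qed.

End Morphisms.

(** * Gradient of a determinant and corank one *)

Section Jacobi.
Variables (C : comNzRingType) (N : nat).
Implicit Types (k : 'I_N).

Lemma mderiv_prod (I : eqType) (r : seq I) (F : I -> {mpoly C[N]}) k : uniq r ->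
  (\prod_(i <- r) F i)^`M(k)
  = \sum_(i <- r) \prod_(j <- r) (if j == i then (F j)^`M(k) else F j).
Proof.
elim: r => [|i r IH] /=; first by rewrite !big_nil -mpolyC1 mderivC.
case/andP=> ir ur; rewrite !big_cons mderivM eqxx IH //; congr (_ * _ + _).
  by apply: eq_big_seq => j jr; case: eqP => // ji; rewrite -ji jr in ir.
rewrite mulr_sumr; apply: eq_big_seq => j jr; rewrite big_cons.
by case: eqP => // ij; rewrite ij jr in ir.
Qed.

Lemma mderiv_det m (A : 'M[{mpoly C[N]}]_m) k :
  (\det A)^`M(k) = \sum_i \sum_j (A i j)^`M(k) * cofactor A i j.
Proof.
(* Leibniz: differentiate one row at a time *)
pose A' i := \matrix_(i', j) (if i' == i then (A i' j)^`M(k) else A i' j).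
transitivity (\sum_i \det (A' i)).
  rewrite raddf_sum /= exchange_big /=; apply: eq_bigr => s _.
  rewrite -signr_odd; case: (odd _); rewrite ?expr1 ?expr0 ?mulN1r ?mul1r.
    rewrite mderivN mderiv_prod ?index_enum_uniq // -sumrN.
    apply: eq_bigr => i _; rewrite mulN1r; congr (- _).
    by apply: eq_bigr => j _; rewrite mxE.
  rewrite mderiv_prod ?index_enum_uniq //.
  apply: eq_bigr => i _; rewrite mul1r.
  by apply: eq_bigr => j _; rewrite mxE.
apply: eq_bigr => i _; rewrite (expand_det_row _ i); apply: eq_bigr => j _.
rewrite mxE eqxx; congr (_ * (_ * \det _)).
by apply/matrixP => a b; rewrite !mxE eq_sym (negPf (neq_lift _ _)).
Qed.

End Jacobi.

(** A nonzero cofactor is a minor of size n, so the rank of [A] is at least n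
    and its kernel at most a line. *)
Lemma corank1_kernel (C : fieldType) n (A : 'M[C]_n.+1) (u v : 'rV_n.+1) :
  \adj A != 0 -> u != 0 -> u *m A = 0 -> v *m A = 0 -> exists k, v = k *: u.
Proof.
move=> adj0 u0 uA vA.
have rA : (n <= \rank A)%N.
  have [i [j cof]] : exists i j, cofactor A i j != 0.
    apply: contrapT => H; case/eqP: adj0; apply/matrixP => j i; rewrite !mxE.
    by apply/eqP; apply: contrapT => /negP ?; apply: H; exists i, j.
  have minor_unit : row' i (col' j A) \in unitmx.
    rewrite unitmxE unitfE; apply: contra_neq cof.
    by rewrite /cofactor => ->; rewrite mulr0.
  have minor_rank : \rank (row' i (col' j A)) = n := mxrank_unit minor_unit.
  rewrite -[leqLHS]minor_rank row'Esub.
  apply: leq_trans (mxrankS (rowsub_sub _ _)) _.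
  rewrite -mxrank_tr tr_col' row'Esub.
  by apply: leq_trans (mxrankS (rowsub_sub _ _)) _; rewrite mxrank_tr.
have uK : (u <= kermx A)%MS by apply/sub_kermxP.
have vK : (v <= kermx A)%MS by apply/sub_kermxP.
apply/sub_rVP; apply: submx_trans vK _.
have rK : (\rank (kermx A) <= \rank u)%N.
  by rewrite mxrank_ker rank_rV u0 leq_subLR addn1 ltnS.
by case: (mxrank_leqif_sup uK) => le <-; rewrite eqn_leq le.
Qed.

(** * Bihomogeneous forms and the projections of a product *)

Section Bidegrees.
Variables n m : nat.

(** The two partial degrees are measures on monomials; this makes the general
    theory of homogeneous polynomials available for [bihomog]. *)
Definition ldeg (mon : 'X_{1..n.+1 + m.+1}) : nat :=
  (\sum_(i < n.+1) mon (lshift m.+1 i))%N.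
Definition rdeg (mon : 'X_{1..n.+1 + m.+1}) : nat :=
  (\sum_(j < m.+1) mon (rshift n.+1 j))%N.

Lemma ldeg0 : ldeg 0%MM = 0%N.
Proof. by rewrite /ldeg big1 // => i _; rewrite mnm0E. Qed.
Lemma ldegD : {morph ldeg : m1 m2 / (m1 + m2)%MM >-> (m1 + m2)%N}.
Proof. by move=> a b; rewrite /ldeg -big_split; apply: eq_bigr => i _; rewrite mnmDE. Qed.
Lemma rdeg0 : rdeg 0%MM = 0%N.
Proof. by rewrite /rdeg big1 // => i _; rewrite mnm0E. Qed.
Lemma rdegD : {morph rdeg : m1 m2 / (m1 + m2)%MM >-> (m1 + m2)%N}.
Proof. by move=> a b; rewrite /rdeg -big_split; apply: eq_bigr => i _; rewrite mnmDE. Qed.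

HB.instance Definition _ := isMeasure.Build _ ldeg ldeg0 ldegD.
HB.instance Definition _ := isMeasure.Build _ rdeg rdeg0 rdegD.

Lemma bihomogP (C : fieldType) de (f : {mpoly C[n.+1 + m.+1]}) :
  bihomog de f <-> f \is de.1.-homog for ldeg /\ f \is de.2.-homog for rdeg.
Proof.
split=> [h|[/dhomogP hl /dhomogP hr] mon mf].
  by split; apply/dhomogP => mon /h[].
by split; [exact: hl | exact: hr].
Qed.

End Bidegrees.
Arguments ldeg {n m}.
Arguments rdeg {n m}.

Section Substitution.
Variable C : fieldType.

Lemma dhomog_comp N N' (mf : measure N') (e : 'I_N -> nat) D
    (tau : N.-tuple {mpoly C[N']}) (f : {mpoly C[N]}) :
  (forall i, tnth tau i \is (e i).-homog for mf) ->
  (forall mon, mon \in msupp f -> (\sum_i e i * mon i)%N = D) ->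
  (f \mPo tau) \is D.-homog for mf.
Proof.
move=> htau hf; rewrite comp_mpolyE big_seq; apply: rpred_sum => mon /hf <-.
apply: rpredZ; elim/big_ind2: _ => [|a p b q hp hq|i _].
- exact: dhomog1.
- exact: dhomogM.
- exact: dhomogMn.
Qed.

Variables n m : nat.
Local Notation XL i := ('X_(lshift m.+1 i) : {mpoly C[n.+1 + m.+1]}).
Local Notation XR j := ('X_(rshift n.+1 j) : {mpoly C[n.+1 + m.+1]}).

Lemma ldeg_XL i : XL i \is 1.-homog for ldeg.
Proof.
rewrite dhomogX /= /ldeg (bigD1 i) //= mnm1E eqxx big1 // => k ki.
by rewrite mnm1E eq_lshift eq_sym (negPf ki).
Qed.
Lemma rdeg_XL i : XL i \is 0.-homog for rdeg.
Proof. by rewrite dhomogX /= /rdeg big1 // => k _; rewrite mnm1E eq_lrshift. Qed.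
Lemma ldeg_XR j : XR j \is 0.-homog for ldeg.
Proof. by rewrite dhomogX /= /ldeg big1 // => k _; rewrite mnm1E eq_rlshift. Qed.
Lemma rdeg_XR j : XR j \is 1.-homog for rdeg.
Proof.
rewrite dhomogX /= /rdeg (bigD1 j) //= mnm1E eqxx big1 // => k kj.
by rewrite mnm1E eq_rshift eq_sym (negPf kj).
Qed.

(** The coordinates of a point of a product, by [bicoordsE]; kept on arbitrary
    families so that each half can be rescaled or substituted separately. *)
Definition pairv (u : 'I_n.+1 -> C) (v : 'I_m.+1 -> C) (i : 'I_(n.+1 + m.+1)) : C :=
  match fintype.split i with inl j => u j | inr j => v j end.

Lemma pairv_l u v i : pairv u v (lshift m.+1 i) = u i.
Proof. by rewrite /pairv; have /= -> := unsplitK (inl i : 'I_n.+1 + 'I_m.+1). Qed.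
Lemma pairv_r u v j : pairv u v (rshift n.+1 j) = v j.
Proof. by rewrite /pairv; have /= -> := unsplitK (inr j : 'I_n.+1 + 'I_m.+1). Qed.

Lemma bicoordsE (p : projProd C n m) :
  coords p = pairv (pvec p.1 0) (pvec p.2 0).
Proof. by []. Qed.

Lemma bihomog_scale de (f : {mpoly C[n.+1 + m.+1]}) u v (k : C) :
  bihomog de f ->
  f.@[pairv u (fun j => k * v j)] = k ^+ de.2 * f.@[pairv u v].
Proof.
move=> hf; rewrite !mevalE mulr_sumr !big_seq; apply: eq_bigr => mon hm.
rewrite mulrCA; congr (_ * _); rewrite !big_split_ord /=.
under eq_bigr do rewrite pairv_l.
under [X in _ * X = _]eq_bigr do rewrite pairv_r exprMn.
under [X in _ = _ * (X * _)]eq_bigr do rewrite pairv_l.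
under [X in _ = _ * (_ * X)]eq_bigr do rewrite pairv_r.
by rewrite [in LHS]big_split /= prodrXr; have [_ ->] := hf _ hm; rewrite mulrCA.
Qed.

End Substitution.

Section Projections.
Variables (C : fieldType) (n m : nat).

Definition lift_fst (f : {mpoly C[n.+1]}) : {mpoly C[n.+1 + m.+1]} :=
  f \mPo [tuple 'X_(lshift m.+1 i) | i < n.+1].

Lemma lift_fst_eval f u v : (lift_fst f).@[pairv u v] = f.@[u].
Proof.
rewrite comp_mpoly_meval; apply: meval_eq => i.
by rewrite tnth_mktuple mevalXU pairv_l.
Qed.

Lemma lift_fst_form d f : f \is d.-homog -> bihomog (d, 0)%N (lift_fst f).
Proof.
move=> /dhomogP hf; apply/bihomogP; split.
  apply: (@dhomog_comp _ _ _ _ (fun=> 1%N)) => [i|mon /hf <-].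
    by rewrite tnth_mktuple ldeg_XL.
  by rewrite /= mdegE; apply: eq_bigr => i _; rewrite mul1n.
apply: (@dhomog_comp _ _ _ _ (fun=> 0%N)) => [i|mon _].
  by rewrite tnth_mktuple rdeg_XL.
by rewrite big1.
Qed.

Lemma morphism_fst (X : set (projProd C n m)) (Y : set (projSpace C n)) :
  (forall p, X p -> Y p.1) -> morphism X Y (fst : projProd C n m -> projSpace C n).
Proof.
move=> XY; apply: (@morphism_by_lifts C (projProd C n m) (projSpace C n) X Y fst
  unit (fun _ _ => lift_fst) (fun _ _ _ => 1) (fun _ _ => True)) => //.
- by move=> _ d; exists (d, 0)%N => f /lift_fst_form.
- by move=> _ d f p _ _; rewrite bicoordsE lift_fst_eval mul1r.
- by move=> _ d p _; rewrite oner_neq0.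
Qed.

Definition lift_swap (f : {mpoly C[m.+1 + n.+1]}) : {mpoly C[n.+1 + m.+1]} :=
  f \mPo [tuple match fintype.split i with
                | inl j => 'X_(rshift n.+1 j)
                | inr j => 'X_(lshift m.+1 j) end | i < m.+1 + n.+1].

Lemma lift_swap_eval f u v : (lift_swap f).@[pairv u v] = f.@[pairv v u].
Proof.
rewrite comp_mpoly_meval; apply: meval_eq => i; rewrite tnth_mktuple.
rewrite [RHS]/pairv.
by case: (fintype.split i) => j; rewrite mevalXU (pairv_l, pairv_r).
Qed.

Lemma lift_swap_form d e f : bihomog (d, e) f -> bihomog (e, d) (lift_swap f).
Proof.
move=> hf; apply/bihomogP; split.
  apply: (@dhomog_comp _ _ _ _
      (fun i => match fintype.split i with inl _ => 0 | inr _ => 1 end)%N).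
    move=> i; rewrite tnth_mktuple.
    by case: (fintype.split i) => j; rewrite (ldeg_XL, ldeg_XR).
  move=> mon /hf /= [_ <-]; rewrite big_split_ord /= big1 ?add0n.
    by apply: eq_bigr => j _; have /= -> := unsplitK (inr j : 'I_m.+1 + 'I_n.+1); rewrite mul1n.
  by move=> j _; have /= -> := unsplitK (inl j : 'I_m.+1 + 'I_n.+1).
apply: (@dhomog_comp _ _ _ _
    (fun i => match fintype.split i with inl _ => 1 | inr _ => 0 end)%N).
  move=> i; rewrite tnth_mktuple.
  by case: (fintype.split i) => j; rewrite (rdeg_XL, rdeg_XR).
move=> mon /hf /= [<- _]; rewrite big_split_ord /= addnC big1 ?add0n.
  by apply: eq_bigr => j _; have /= -> := unsplitK (inl j : 'I_m.+1 + 'I_n.+1); rewrite mul1n.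
by move=> j _; have /= -> := unsplitK (inr j : 'I_m.+1 + 'I_n.+1).
Qed.

Definition pswap (p : projProd C n m) : projProd C m n := (p.2, p.1).

Lemma morphism_swap (X : set (projProd C n m)) (Y : set (projProd C m n)) :
  (forall p, X p -> Y (pswap p)) -> morphism X Y pswap.
Proof.
move=> XY; apply: (@morphism_by_lifts C (projProd C n m) (projProd C m n) X Y pswap
  unit (fun _ _ => lift_swap) (fun _ _ _ => 1) (fun _ _ => True)) => //.
- by move=> _ [d e]; exists (e, d) => f /lift_swap_form.
- by move=> _ d f p _ _; rewrite bicoordsE lift_swap_eval mul1r.
- by move=> _ d p _; rewrite oner_neq0.
Qed.

End Projections.

Lemma isomorphism_swap (C : fieldType) n m
    (X : set (projProd C n m)) (Y : set (projProd C m n)) :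
  (forall p, X p <-> Y (pswap p)) -> isomorphism X Y (@pswap C n m).
Proof.
move=> XY; split; first by apply: morphism_swap => p /XY.
exists (@pswap C m n); split=> [|[p q]|[p q]] //.
by apply: morphism_swap => -[p q] Yp; apply/XY.
Qed.

(** * Determinantal hypersurfaces *)

Definition bilinear_form (C : fieldType) n m (M : 'M[C]_(n.+1, m.+1)) :
    {mpoly C[n.+1 + m.+1]} :=
  \sum_i \sum_j M i j *: ('X_(lshift m.+1 i) * 'X_(rshift n.+1 j)).

Lemma mderivXU (C : comNzRingType) n (i k : 'I_n) :
  ('X_i : {mpoly C[n]})^`M(k) = (i == k)%:R.
Proof.
rewrite mderivX mnm1E; case: eqP => [->|_]; last by rewrite scale0r.
rewrite scale1r -mpolyX0; congr 'X_[_].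
by apply/mnmP => j; rewrite mnmBE subnn mnm0E.
Qed.

Section Determinantal.
Variables (C : fieldType) (n : nat) (M : 'I_n.+1 -> 'M[C]_n.+1).

Definition bilinear_system : n.+1.-tuple {mpoly C[n.+1 + n.+1]} :=
  [tuple bilinear_form (M q) | q < n.+1].

Definition bilinear_locus : set (projProd C n n) :=
  @zlocus C (projProd C n n) [set` bilinear_system].

(** Row [q], column [j]: the coefficient of y_j in the form number [q], a linear
    form in x.  [evalmx x] is its value at x. *)
Definition formmx : 'M[{mpoly C[n.+1]}]_n.+1 :=
  \matrix_(q, j) \sum_i M q i j *: 'X_i.

Definition evalmx (x : 'rV[C]_n.+1) : 'M[C]_n.+1 :=
  \matrix_(q, j) (x *m M q) 0 j.

Lemma bilinear_form_eval q u v :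
  (bilinear_form (M q)).@[pairv u v] = \sum_i \sum_j M q i j * (u i * v j).
Proof.
rewrite /bilinear_form raddf_sum; apply: eq_bigr => i _ /=.
rewrite raddf_sum; apply: eq_bigr => j _ /=.
by rewrite mevalZ mevalM !mevalXU pairv_l pairv_r.
Qed.

Lemma evalmx_bilinear (x y : 'rV[C]_n.+1) q :
  (bilinear_form (M q)).@[pairv (x 0) (y 0)] = (y *m (evalmx x)^T) 0 q.
Proof.
rewrite bilinear_form_eval exchange_big mxE; apply: eq_bigr => j _.
rewrite !mxE mulr_sumr; apply: eq_bigr => i _.
by rewrite mulrA mulrC [M q i j * _]mulrC.
Qed.

Lemma bilinear_locusP (p : projProd C n n) :
  bilinear_locus p <-> pvec p.2 *m (evalmx (pvec p.1))^T = 0.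
Proof.
split=> [H|H f].
  apply/rowP => q; rewrite -evalmx_bilinear mxE.
  by apply: H => /=; apply/mapP; exists q; rewrite ?mem_enum.
move=> fS; have /mapP[q _ ->] : f \in tval bilinear_system := fS.
by rewrite bicoordsE evalmx_bilinear H mxE.
Qed.

Lemma map_formmx (x : 'rV[C]_n.+1) : map_mx (meval (x 0)) formmx = evalmx x.
Proof.
apply/matrixP => q j; rewrite !mxE raddf_sum; apply: eq_bigr => i _ /=.
by rewrite mevalZ mevalXU mulrC.
Qed.

Lemma mderiv_formmx q j k : (formmx q j)^`M(k) = (M q k j)%:MP.
Proof.
rewrite mxE raddf_sum (bigD1 k) //= big1 ?addr0 => [|i ik]; rewrite mderivZ mderivXU.
  by rewrite eqxx -mul_mpolyC mulr1.
by rewrite (negPf ik) scaler0.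
Qed.

Lemma mderiv_bilinear_l q i u v :
  ((bilinear_form (M q))^`M(lshift n.+1 i)).@[pairv u v] = \sum_j M q i j * v j.
Proof.
transitivity (\sum_i' \sum_j M q i' j * ((i' == i)%:R * v j)).
  rewrite /bilinear_form (raddf_sum (mderiv _)) (raddf_sum (meval _)) /=.
  apply: eq_bigr => i' _; rewrite (raddf_sum (mderiv _)) (raddf_sum (meval _)) /=.
  apply: eq_bigr => j _; rewrite mderivZ mevalZ mderivM !mderivXU eq_rlshift.
  by rewrite eq_lshift mulr0 addr0 mevalM mevalXU pairv_r rmorph_nat.
rewrite (bigD1 i) //= [X in _ + X]big1 ?addr0 => [|i' /negPf ->].
  by apply: eq_bigr => j _; rewrite eqxx mul1r.
by rewrite big1 // => j _; rewrite mul0r mulr0.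
Qed.

Lemma mderiv_bilinear_r q j u v :
  ((bilinear_form (M q))^`M(rshift n.+1 j)).@[pairv u v] = \sum_i u i * M q i j.
Proof.
rewrite /bilinear_form (raddf_sum (mderiv _)) (raddf_sum (meval _)) /=.
apply: eq_bigr => i _; rewrite (raddf_sum (mderiv _)) (raddf_sum (meval _)) /=.
transitivity (\sum_j' M q i j' * (u i * (j' == j)%:R)).
  apply: eq_bigr => j' _; rewrite mderivZ mevalZ mderivM !mderivXU eq_lrshift.
  by rewrite eq_rshift mul0r add0r mevalM mevalXU pairv_l rmorph_nat.
rewrite (bigD1 j) //= [X in _ + X]big1 ?addr0 => [|j' /negPf ->].
  by rewrite eqxx mulr1 mulrC.
by rewrite !mulr0.
Qed.

Lemma bilinear_form_bihomog q : bihomog (1, 1)%N (bilinear_form (M q)).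
Proof.
apply/bihomogP; split; do 2![apply: rpred_sum => ? _]; apply: rpredZ.
  exact: (dhomogM (ldeg_XL _ _ _) (ldeg_XR _ _ _)).
exact: (dhomogM (rdeg_XL _ _ _) (rdeg_XR _ _ _)).
Qed.

Variables (G : {mpoly C[n.+1]}) (c : C).
Hypotheses (c0 : c != 0) (detG : \det (formmx) = c *: G).
Hypothesis smoothG : forall x : 'rV[C]_n.+1, x != 0 -> G.@[x 0] = 0 ->
  exists k, (G^`M(k)).@[x 0] != 0.

Let X : set (projSpace C n) := @zlocus C (projSpace C n) [set G].

Lemma det_evalmx (x : 'rV[C]_n.+1) : \det (evalmx x) = c * G.@[x 0].
Proof. by rewrite -map_formmx det_map_mx detG /= mevalZ. Qed.

(** Jacobi's formula: the k-th partial derivative of the (q, j) entry of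
    [formmx] is the constant [M q k j]. *)
Lemma gradient_evalmx (x : 'rV[C]_n.+1) k :
  c * (G^`M(k)).@[x 0] = \sum_q \sum_j M q k j * cofactor (evalmx x) q j.
Proof.
rewrite -mevalZ -mderivZ -detG mderiv_det (raddf_sum (meval _)) /=.
apply: eq_bigr => q _; rewrite (raddf_sum (meval _)) /=.
apply: eq_bigr => j _; rewrite mevalM mderiv_formmx mevalC; congr (_ * _).
by rewrite -map_formmx cofactor_map_mx.
Qed.

Lemma hypersurfaceP (p : projSpace C n) : X p <-> G.@[pvec p 0] = 0.
Proof. by split=> [|H f ->]; [exact | exact: H]. Qed.

(** If the adjugate vanished, so would every cofactor, and with them the whole
    gradient of [G]. *)
Lemma adj_evalmx_neq0 (p : projSpace C n) : X p -> \adj (evalmx (pvec p)) != 0.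
Proof.
move=> /hypersurfaceP Gp; apply/eqP => adj0.
have [k] := smoothG (pvec_neq0 p) Gp; rewrite -(mulrI_eq0 _ (mulfI c0)).
rewrite gradient_evalmx => /eqP[]; rewrite big1 // => q _; rewrite big1 // => j _.
by move/matrixP/(_ j q): adj0; rewrite !mxE => ->; rewrite mulr0.
Qed.

Lemma bilinear_locus_fst (p : projProd C n n) : bilinear_locus p -> X p.1.
Proof.
move=> /bilinear_locusP ker; apply/hypersurfaceP/eqP.
rewrite -(mulrI_eq0 _ (mulfI c0)) -det_evalmx -det_tr.
by apply/det0P; exists (pvec p.2); first exact: pvec_neq0.
Qed.

Lemma bilinear_locus_fiber (p : projSpace C n) : X p ->
  exists q : projSpace C n, bilinear_locus (p, q).
Proof.
move=> /hypersurfaceP Gp.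
have /eqP/det0P[y y0 yA] : \det (evalmx (pvec p))^T = 0.
  by rewrite det_tr det_evalmx Gp mulr0.
exists (pt_of y0); apply/bilinear_locusP => /=.
have [k k0 ey] := pvec_pt_of y0.
by apply: (scalerI k0); rewrite scaler0 scalemxAl -ey.
Qed.

Lemma bilinear_locus_inj (p q q' : projSpace C n) :
  bilinear_locus (p, q) -> bilinear_locus (p, q') -> q = q'.
Proof.
move=> S S'; have Xp := bilinear_locus_fst S.
have adj0 : \adj (evalmx (pvec p))^T != 0.
  by rewrite -trmx_adj trmx_eq0 adj_evalmx_neq0.
move/bilinear_locusP: S => /= S; move/bilinear_locusP: S' => /= S'.
have [k e] := corank1_kernel adj0 (pvec_neq0 q') S' S.
exact: ppoint_eq e.
Qed.

(** The columns of the adjugate lie in the kernel of [evalmx], a line spanned by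
    [pvec q]; proportionality is stated without division. *)
Lemma adj_column (p q : projSpace C n) i j k : bilinear_locus (p, q) ->
  (\adj (evalmx (pvec p))) j i * pvec q 0 k
  = (\adj (evalmx (pvec p))) k i * pvec q 0 j.
Proof.
move=> S; have Xp := bilinear_locus_fst S.
have adj0 : \adj (evalmx (pvec p))^T != 0.
  by rewrite -trmx_adj trmx_eq0 adj_evalmx_neq0.
set A := evalmx _ in adj0 *.
have col_ker : row i (\adj A)^T *m A^T = 0.
  rewrite -row_mul -trmx_mul mul_mx_adj det_evalmx.
  by move/hypersurfaceP: Xp => -> ; rewrite mulr0 raddf0 trmx0 row0.
move/bilinear_locusP: S => /= S.
have [t e] := corank1_kernel adj0 (pvec_neq0 q) S col_ker.
have adjE l : \adj A l i = t * pvec q 0 l.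
  by have /rowP/(_ l) := e; rewrite !mxE.
by rewrite !adjE mulrAC.
Qed.

(** The inverse of the first projection; the default value of [xget] matters
    only outside the hypersurface. *)
Definition kernel_point (p : projSpace C n) : projProd C n n :=
  (p, xget (p : ppoint C n) [set q | bilinear_locus (p, q)]).

Lemma kernel_pointP p : X p -> bilinear_locus (kernel_point p).
Proof.
by move=> /bilinear_locus_fiber ex; apply: (xgetPex (p : ppoint C n) ex).
Qed.

(** Substitutes column [ij.1] of the adjugate for y.  The extra factor, an entry
    of that column, makes the pullback vanish wherever the entry does, also for
    forms of degree 0 in y. *)
Definition adj_lift (ij : 'I_n.+1 * 'I_n.+1) (f : {mpoly C[n.+1 + n.+1]}) :
    {mpoly C[n.+1]} :=
  (\adj formmx) ij.2 ij.1 *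
  (f \mPo [tuple match fintype.split l with
                 | inl k => 'X_k
                 | inr k => (\adj formmx) k ij.1 end | l < n.+1 + n.+1]).

Lemma dhomog_adj_formmx j i : (\adj formmx) j i \is n.-homog.
Proof.
rewrite mxE /cofactor -signr_odd; set d := \det _.
suff hd : d \is n.-homog.
  by case: (odd _); rewrite ?expr0 ?mul1r // expr1 mulN1r rpredN.
apply: rpred_sum => s _; rewrite -signr_odd; set e := \prod_(_ < _) _.
suff he : e \is n.-homog.
  by case: (odd _); rewrite ?expr0 ?mul1r // expr1 mulN1r rpredN.
suff : e \is (\sum_(k < n.+1.-1) 1).-homog by rewrite sum1_card card_ord.
rewrite {}/e; elim/big_ind2: _ => [|a p b q hp hq|k _].
- exact: dhomog1.
- exact: dhomogM.
- rewrite !mxE; apply: rpred_sum => l _; apply: rpredZ.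
  by rewrite dhomogX /= mdeg1.
Qed.

Lemma adj_formmx_eval (x : 'rV[C]_n.+1) j i :
  ((\adj formmx) j i).@[x 0] = (\adj (evalmx x)) j i.
Proof. by rewrite -map_formmx -map_mx_adj [in RHS]mxE. Qed.

Lemma adj_lift_form ij de (f : {mpoly C[n.+1 + n.+1]}) : bihomog de f ->
  adj_lift ij f \is (n + (de.1 + de.2 * n)).-homog.
Proof.
move=> hf; apply: dhomogM; first exact: dhomog_adj_formmx.
apply: (@dhomog_comp _ _ _ _
    (fun l => match fintype.split l with inl _ => 1 | inr _ => n end)%N).
  move=> l; rewrite tnth_mktuple; case: (fintype.split l) => k.
    by rewrite dhomogX /= mdeg1.
  exact: dhomog_adj_formmx.
move=> mon /hf [<- <-]; rewrite big_split_ord /=; congr (_ + _)%N.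
  by apply: eq_bigr => k _; have /= -> := unsplitK (inl k : 'I_n.+1 + 'I_n.+1); rewrite mul1n.
rewrite big_distrl; apply: eq_bigr => k _.
by have /= -> := unsplitK (inr k : 'I_n.+1 + 'I_n.+1); rewrite mulnC.
Qed.

(** If column i of the adjugate is k times the coordinates of the kernel point,
    substituting it in a form of degree e in y multiplies the value by k ^ e;
    here k is the quotient of the entries number j, for any j where the column
    does not vanish. *)
Lemma morphism_kernel_point : morphism X bilinear_locus kernel_point.
Proof.
pose adjp (p : projSpace C n) := \adj (evalmx (pvec p)).
apply: (@morphism_by_lifts C (projSpace C n) (projProd C n n) X bilinear_locus
  kernel_point ('I_n.+1 * 'I_n.+1) (fun ij _ => adj_lift ij)
  (fun ij de p => adjp p ij.2 ij.1 *
     (adjp p ij.2 ij.1 / pvec (kernel_point p).2 0 ij.2) ^+ de.2)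
  (fun ij p => adjp p ij.2 ij.1 != 0)).
- exact: kernel_pointP.
- by move=> ij de; exists (n + (de.1 + de.2 * n))%N => f; apply: adj_lift_form.
- move=> [i j] de f p Xp hf; rewrite coordsE bicoordsE /= mevalM adj_formmx_eval -mulrA -/(adjp p).
  have [->|a0] := eqVneq (adjp p j i) 0; first by rewrite !mul0r.
  have ker := kernel_pointP Xp; congr (_ * _).
  have y0 : pvec (kernel_point p).2 0 j != 0.
    apply/eqP => yj; case/eqP: (pvec_neq0 (kernel_point p).2).
    apply/rowP => k; rewrite mxE; apply/eqP; rewrite -(mulrI_eq0 _ (mulfI a0)).
    by rewrite (adj_column i j k ker) yj mulr0.
  rewrite -(bihomog_scale _ _ _ hf) comp_mpoly_meval; apply: meval_eq => l.
  rewrite tnth_mktuple /pairv; case: (fintype.split l) => k.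
    by rewrite mevalXU.
  rewrite adj_formmx_eval -/(adjp p); apply: (mulIf y0).
  by rewrite mulrAC divfK // (adj_column i j k ker).
- move=> [i j] de p Xp /=; split; first by apply: contra_neq => ->; rewrite mul0r.
  move=> a0; rewrite mulf_neq0 // expf_neq0 // mulf_neq0 // invr_eq0.
  have ker := kernel_pointP Xp.
  apply/eqP => yj; case/eqP: (pvec_neq0 (kernel_point p).2).
  apply/rowP => k; rewrite mxE; apply/eqP; rewrite -(mulrI_eq0 _ (mulfI a0)).
  by rewrite (adj_column i j k ker) yj mulr0.
- move=> p Xp; apply: contrapT => H; case/eqP: (adj_evalmx_neq0 Xp).
  apply/matrixP => j i; rewrite [RHS]mxE; apply/eqP; apply: contrapT => /negP a0.
  by apply: H; exists (i, j).
Qed.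

Theorem determinantal_isomorphism :
  isomorphism bilinear_locus X (fst : projProd C n n -> projSpace C n).
Proof.
split; first exact: morphism_fst bilinear_locus_fst.
exists kernel_point; split=> [|[p q] S|p Xp] //; first exact: morphism_kernel_point.
congr pair; apply/esym/(bilinear_locus_inj S).
exact: kernel_pointP (bilinear_locus_fst S).
Qed.

(** A left kernel vector [lam] of the Jacobian matrix is in the left kernel of
    [evalmx x], from the derivatives in y.  Both kernels of [evalmx x] being
    lines, adj(j, q) is a constant times lam_q y_j.  The derivatives in x then
    express that the gradient of [G] at x vanishes. *)
Theorem determinantal_smooth_ci : X !=set0 ->
  @smooth_complete_intersection C (projProd C n n) n.+1 bilinear_system.
Proof.
move=> [p Xp]; split.
- by move=> q; exists (1, 1)%N; rewrite tnth_mktuple; apply: bilinear_form_bihomog.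
- by exists (kernel_point p); apply: kernel_pointP.
- move=> {Xp}p S; apply/eqP; apply: inj_row_free => lam J0.
  have Xp := bilinear_locus_fst S; set x := pvec p.1; set y := pvec p.2.
  have lamA : lam *m evalmx x = 0.
    apply/rowP => j; have /rowP/(_ (rshift n.+1 j)) := J0; rewrite !mxE; apply: etrans.
    apply: eq_bigr => q _; rewrite !mxE tnth_mktuple; congr (_ * _).
    by rewrite bicoordsE mderiv_bilinear_r.
  have lamB k : \sum_q lam 0 q * \sum_j M q k j * y 0 j = 0.
    have /rowP/(_ (lshift n.+1 k)) := J0; rewrite !mxE; apply: etrans.
    apply: eq_bigr => q _; rewrite !mxE tnth_mktuple; congr (_ * _).
    by rewrite bicoordsE mderiv_bilinear_l.
  apply/eqP; apply: contrapT => /negP lam0.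
  have detA : \det (evalmx x) = 0.
    by rewrite det_evalmx; move/hypersurfaceP: Xp => ->; rewrite mulr0.
  have adj0 := adj_evalmx_neq0 Xp.
  have row_lam j : exists t, row j (\adj (evalmx x)) = t *: lam.
    apply: corank1_kernel adj0 lam0 lamA _.
    by rewrite -row_mul mul_adj_mx detA raddf0 row0.
  have [j0 y0] : exists j0, y 0 j0 != 0.
    apply: contrapT => H; case/eqP: (pvec_neq0 p.2); apply/rowP => j.
    by rewrite mxE; apply/eqP; apply: contrapT => /negP yj; apply: H; exists j.
  have [t et] := row_lam j0.
  have adjE j q : (\adj (evalmx x)) j q = t / y 0 j0 * (lam 0 q * y 0 j).
    apply: (mulIf y0); have Sp : bilinear_locus (p.1, p.2) by case: (p) S.
    rewrite (adj_column q j j0 Sp) -/y -/x.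
    have /rowP/(_ q) := et; rewrite !mxE => ->.
    by rewrite [RHS]mulrAC divfK // mulrA.
  have /hypersurfaceP Gp := Xp.
  have [k] := smoothG (pvec_neq0 p.1) Gp; rewrite -(mulrI_eq0 _ (mulfI c0)).
  rewrite gradient_evalmx => /eqP[].
  transitivity (t / y 0 j0 * \sum_q lam 0 q * \sum_j M q k j * y 0 j).
    rewrite mulr_sumr; apply: eq_bigr => q _; rewrite !mulr_sumr.
    apply: eq_bigr => j _; have := adjE j q; rewrite mxE => ->.
    by rewrite mulrCA; congr (_ * _); rewrite mulrCA.
  by rewrite lamB mulr0.
Qed.

End Determinantal.

(** Exchanging the factors transposes each matrix of coefficients, which reduces
    the second projection to the first. *)
Lemma bilinear_locus_swap (C : fieldType) n (M : 'I_n.+1 -> 'M[C]_n.+1)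
    (p : projProd C n n) :
  bilinear_locus M p <-> bilinear_locus (fun q => (M q)^T) (pswap p).
Proof.
have sw q u v : (bilinear_form (M q)^T).@[pairv v u] = (bilinear_form (M q)).@[pairv u v].
  rewrite (bilinear_form_eval (fun q => (M q)^T)) bilinear_form_eval exchange_big.
  apply: eq_bigr => i _; apply: eq_bigr => j _.
  by rewrite mxE [v j * _]mulrC.
split=> /bilinear_locusP/rowP H; apply/bilinear_locusP/rowP => q; have := H q.
  by rewrite -(evalmx_bilinear (fun q => (M q)^T)) -evalmx_bilinear sw.
by rewrite -(evalmx_bilinear (fun q => (M q)^T)) -evalmx_bilinear sw.
Qed.

Theorem determinantal_isomorphism_snd (C : fieldType) n (M : 'I_n.+1 -> 'M[C]_n.+1)
    (G : {mpoly C[n.+1]}) (c : C) :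
  c != 0 -> \det (formmx (fun q => (M q)^T)) = c *: G ->
  (forall y : 'rV[C]_n.+1, y != 0 -> G.@[y 0] = 0 ->
     exists k, (G^`M(k)).@[y 0] != 0) ->
  isomorphism (bilinear_locus M) (@zlocus C (projSpace C n) [set G])
    (snd : projProd C n n -> projSpace C n).
Proof.
move=> c0 detG smoothG.
have iso_swap := isomorphism_swap (bilinear_locus_swap M).
exact: isomorphism_comp iso_swap (determinantal_isomorphism c0 detG smoothG).
Qed.

(** * Polynomial identities with coefficients in Z[z], z^4 = -1 *)

(** [Cyc a b c d] stands for a + b z + c z^2 + d z^3. *)
Inductive cyc := Cyc of Z & Z & Z & Z.

Definition cyc_add '(Cyc a b c d) '(Cyc a' b' c' d') :=
  Cyc (Z.add a a') (Z.add b b') (Z.add c c') (Z.add d d').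
Definition cyc_opp '(Cyc a b c d) :=
  Cyc (Z.opp a) (Z.opp b) (Z.opp c) (Z.opp d).
Definition cyc_sub x y := cyc_add x (cyc_opp y).
Definition cyc_mul '(Cyc a b c d) '(Cyc a' b' c' d') :=
  let dot p q r s := Z.add (Z.add p q) (Z.add r s) in
  let '(b_, c_, d_) := (Z.opp b', Z.opp c', Z.opp d') in
  let m := Z.mul in
  Cyc (dot (m a a') (m b d_) (m c c_) (m d b_))
      (dot (m a b') (m b a') (m c d_) (m d c_))
      (dot (m a c') (m b b') (m c a') (m d d_))
      (dot (m a d') (m b c') (m c b') (m d a')).
Definition cyc_int (n : Z) := Cyc n Z0 Z0 Z0.
Definition cyc0 := cyc_int Z0.
Definition cyc1 := cyc_int (Zpos xH).
Definition cyc_eqb '(Cyc a b c d) '(Cyc a' b' c' d') :=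
  [&& Z.eqb a a', Z.eqb b b', Z.eqb c c' & Z.eqb d d'].

(** The product of the three other conjugates under z -> z^3, z^5, z^7; the
    product with [x] is the norm, a nonzero integer when [x] is nonzero. *)
Definition cyc_cofactor '(Cyc a b c d) : cyc :=
  cyc_mul (Cyc a d (Z.opp c) b)
    (cyc_mul (Cyc a (Z.opp b) c (Z.opp d)) (Cyc a (Z.opp d) (Z.opp c) (Z.opp b))).
Definition cyc_nz x :=
  let: Cyc n b c d := cyc_mul x (cyc_cofactor x) in
  [&& ~~ Z.eqb n Z0, Z.eqb b Z0, Z.eqb c Z0 & Z.eqb d Z0].

Lemma cyc_eqP x y : reflect (x = y) (cyc_eqb x y).
Proof.
case: x => a b c d; case: y => a' b' c' d'; apply: (iffP and4P).
  by case=> /Z.eqb_eq -> /Z.eqb_eq -> /Z.eqb_eq -> /Z.eqb_eq ->.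
by case=> -> -> -> ->; split; apply/Z.eqb_eq.
Qed.

HB.instance Definition _ := hasDecEq.Build cyc cyc_eqP.

Definition zeval (R : nzRingType) (n : Z) : R := (int_of_Z n)%:~R.

Definition ceval (R : nzRingType) (z : R) '(Cyc a b c d) : R :=
  zeval R a + zeval R b * z + zeval R c * z ^+ 2 + zeval R d * z ^+ 3.

(** Values of the polynomial expressions of the ring tactic, for the coefficient
    morphism [ceval z]. *)
Definition peval (R : comNzRingType) (z : R) : seq R -> PExpr cyc -> R :=
  PEeval 0 1 +%R *%R (fun x y => x - y) -%R (ceval z) N.to_nat (@GRing.exp R).

Section Evaluation.
Variables (R : comNzRingType) (z : R).
Hypothesis z4 : z ^+ 4 = -1.

Lemma zevalD m n : zeval R (Z.add m n) = zeval R m + zeval R n.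
Proof. by rewrite /zeval -intrD -raddfD. Qed.
Lemma zevalM m n : zeval R (Z.mul m n) = zeval R m * zeval R n.
Proof. by rewrite /zeval -intrM -rmorphM. Qed.
Lemma zevalN m : zeval R (Z.opp m) = - zeval R m.
Proof. by rewrite /zeval -mulrNz -raddfN. Qed.

Lemma cevalD x y : ceval z (cyc_add x y) = ceval z x + ceval z y.
Proof. by case: x => a b c d; case: y => a' b' c' d' /=; rewrite !zevalD; ring. Qed.
Lemma cevalN x : ceval z (cyc_opp x) = - ceval z x.
Proof. by case: x => a b c d /=; rewrite !zevalN; ring. Qed.
Lemma cevalB x y : ceval z (cyc_sub x y) = ceval z x - ceval z y.
Proof. by rewrite cevalD cevalN. Qed.
Lemma cevalM x y : ceval z (cyc_mul x y) = ceval z x * ceval z y.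
Proof.
case: x => a b c d; case: y => a' b' c' d' /=.
by rewrite !(zevalD, zevalM) !zevalN; ring: z4.
Qed.
Lemma ceval_int n : ceval z (cyc_int n) = zeval R n.
Proof. by rewrite /= /zeval /=; ring. Qed.
Lemma ceval0 : ceval z cyc0 = 0.
Proof. by rewrite ceval_int. Qed.
Lemma ceval1 : ceval z cyc1 = 1.
Proof. by rewrite ceval_int. Qed.

Lemma ceval_morph : ring_morph 0 1 +%R *%R (fun x y : R => x - y) -%R eq
  cyc0 cyc1 cyc_add cyc_mul cyc_sub cyc_opp cyc_eqb (ceval z).
Proof.
split; [exact: ceval0 | exact: ceval1 | exact: cevalD | exact: cevalB
      | exact: cevalM | exact: cevalN |].
by move=> x y /cyc_eqP ->.
Qed.

Lemma peval_ring_theory :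
  ring_theory 0 1 +%R *%R (fun x y : R => x - y) -%R eq.
Proof.
by split=> *; rewrite ?(add0r, addrA, mul1r, mulrA, mulrDl, subrr) // (addrC, mulrC).
Qed.

Lemma peval_power_theory : power_theory 1 *%R eq N.to_nat (@GRing.exp R).
Proof.
split=> x [|p] //=; elim: p => [p IH|p IH|] //=.
  by rewrite Pos2Nat.inj_xI -IH exprS -exprD addnn -mul2n.
by rewrite Pos2Nat.inj_xO -IH -exprD addnn -mul2n.
Qed.

Definition pnorm := norm_subst cyc0 cyc1 cyc_add cyc_mul cyc_sub cyc_opp cyc_eqb
  (triv_div cyc0 cyc1 cyc_eqb) 0 nil.
(** Equality of Horner normal forms with coefficients in [cyc]. *)
Definition same_poly e1 e2 := Ring_polynom.Peq cyc_eqb (pnorm e1) (pnorm e2).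

Lemma same_polyP e1 e2 env : same_poly e1 e2 -> peval z env e1 = peval z env e2.
Proof.
have ext := Eq_ext (+%R : R -> R -> R) *%R -%R.
have eqv := RelationClasses.eq_equivalence (A := R).
have ARth := Rth_ARth eqv ext peval_ring_theory.
move=> h; apply: (ring_correct eqv ext ARth ceval_morph peval_power_theory
  (triv_div_th eqv ext ARth ceval_morph) 0%N env nil e1 e2) => //.
Qed.

End Evaluation.

Section Morphisms.
Variables (R S : comNzRingType) (f : {rmorphism R -> S}) (z : R).

Lemma ceval_rmorph x : ceval (f z) x = f (ceval z x).
Proof.
by case: x => a b c d; rewrite /= !(rmorphD, rmorphXn, rmorphM) /zeval !rmorph_int.
Qed.

Lemma blnth_map (A B : Type) (g : A -> B) d p (s : seq A) :
  BinList.nth (g d) p [seq g x | x <- s] = g (BinList.nth d p s).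
Proof.
have tl_map (l : seq A) : List.tl (map g l) = map g (List.tl l) by case: l.
have hd_map (l : seq A) : List.hd (g d) (map g l) = g (List.hd d l) by case: l.
have jump_map q : forall l : seq A, BinList.jump q (map g l) = map g (BinList.jump q l).
  by elim: q => [q IH|q IH|] l //=; rewrite ?tl_map ?IH ?IH.
by elim: p s => [p IH|p IH|] s /=; rewrite ?tl_map ?jump_map ?IH ?hd_map.
Qed.

Lemma peval_rmorph env e :
  peval (f z) [seq f x | x <- env] e = f (peval z env e).
Proof.
elim: e => //= [||c|p|e1 IH1 e2 IH2|e1 IH1 e2 IH2|e1 IH1 e2 IH2|e1 IH1|e1 IH1 n].
- by rewrite rmorph0.
- by rewrite rmorph1.
- exact: ceval_rmorph.
- by rewrite -(rmorph0 f) blnth_map.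
- by rewrite rmorphD -IH1 -IH2.
- by rewrite rmorphB -IH1 -IH2.
- by rewrite rmorphM -IH1 -IH2.
- by rewrite rmorphN -IH1.
- by rewrite rmorphXn -IH1.
Qed.

End Morphisms.

Fixpoint psubst (s : seq (PExpr cyc)) (e : PExpr cyc) : PExpr cyc :=
  match e with
  | PEO => PEO
  | PEI => PEI
  | PEc c => PEc c
  | PEX j => BinList.nth PEO j s
  | PEadd a b => PEadd (psubst s a) (psubst s b)
  | PEsub a b => PEsub (psubst s a) (psubst s b)
  | PEmul a b => PEmul (psubst s a) (psubst s b)
  | PEopp a => PEopp (psubst s a)
  | PEpow a n => PEpow (psubst s a) n
  end.

Lemma peval_subst (R : comNzRingType) (z : R) env s e :
  peval z env (psubst s e) = peval z [seq peval z env x | x <- s] e.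
Proof.
elim: e => //= [p|a IHa b IHb|a IHa b IHb|a IHa b IHb|a IHa|a IHa n].
- by rewrite -(blnth_map (peval z env)).
- by congr (_ + _).
- by congr (_ - _).
- by congr (_ * _).
- by congr (- _).
- by congr (_ ^+ _).
Qed.

Fixpoint pderiv (k : positive) (e : PExpr cyc) : PExpr cyc :=
  match e with
  | PEX j => if Pos.eqb j k then PEI else PEO
  | PEadd a b => PEadd (pderiv k a) (pderiv k b)
  | PEsub a b => PEsub (pderiv k a) (pderiv k b)
  | PEmul a b => PEadd (PEmul (pderiv k a) b) (PEmul a (pderiv k b))
  | PEopp a => PEopp (pderiv k a)
  | _ => PEO
  end.

Fixpoint pow_free (e : PExpr cyc) : bool :=
  match e with
  | PEadd a b | PEsub a b | PEmul a b => pow_free a && pow_free b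
  | PEopp a => pow_free a
  | PEpow _ _ => false
  | _ => true
  end.

(** A membership certificate: the combination of generators of an ideal with
    given cofactors. *)
Fixpoint combine (cofactors gens : seq (PExpr cyc)) : PExpr cyc :=
  match cofactors, gens with
  | h :: hs, g :: gs => PEadd (PEmul h g) (combine hs gs)
  | _, _ => PEO
  end.

Lemma ideal_member (R : comNzRingType) (z : R) env cofactors gens e :
  z ^+ 4 = -1 -> same_poly e (combine cofactors gens) ->
  (forall i, (i < size gens)%N -> peval z env (nth PEO gens i) = 0) ->
  peval z env e = 0.
Proof.
move=> z4 /(same_polyP z4 env) -> {e}.
elim: cofactors gens => [|h hs IH] [|g gs] //= gens0.
have g0 := gens0 0%N isT; have IHgs := IH gs (fun i => gens0 i.+1).
by rewrite [X in _ * X]g0 mulr0 add0r.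
Qed.

Section NumField.
Variables (C : numFieldType) (z : C).
Hypothesis z4 : z ^+ 4 = -1.

Lemma zeval_eq0 n : (zeval C n == 0) = Z.eqb n Z0.
Proof.
rewrite /zeval intr_eq0; apply/eqP/idP => [n0|/Z.eqb_eq -> //].
by apply/Z.eqb_eq; rewrite -[n]int_of_ZK n0.
Qed.

Lemma ceval_neq0 x : cyc_nz x -> ceval z x != 0.
Proof.
rewrite /cyc_nz; case E: (cyc_mul x (cyc_cofactor x)) => [n b c d].
case/and4P=> n0 /Z.eqb_eq b0 /Z.eqb_eq c0 /Z.eqb_eq d0; subst b c d.
have : ceval z x * ceval z (cyc_cofactor x) != 0.
  by rewrite -(cevalM z4) E (ceval_int z n) zeval_eq0.
by rewrite mulf_eq0 negb_or => /andP[].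
Qed.

End NumField.

Notation ord4 k := (@Ordinal 4 k isT).

Lemma jump_drop (A : Type) p (s : seq A) : BinList.jump p s = drop (Pos.to_nat p) s.
Proof.
elim: p s => [p IH|p IH|] s /=; last by case: s => //= a s; rewrite drop0.
  rewrite !IH Pos2Nat.inj_xI multE drop_drop mul2n addnn -addn1 -drop_drop.
  by case: s => //= a s; rewrite ?drop0. 
by rewrite !IH Pos2Nat.inj_xO multE drop_drop mul2n addnn.
Qed.

(** [BinList.nth] counts from 1, hence the predecessor. *)
Lemma blnthE (A : Type) (d : A) p s : BinList.nth d p s = nth d s (Pos.to_nat p).-1.
Proof.
have hdE (l : seq A) : List.hd d l = nth d l 0 by case: l.
have tlE (l : seq A) : List.tl l = drop 1 l by case: l => //= a l; rewrite drop0.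
elim: p s => [p IH|p IH|] s; rewrite [LHS]/= ?hdE // IH jump_drop nth_drop; last first.
  rewrite Pos2Nat.inj_xO multE mul2n -addnn; have /ltP := Pos2Nat.is_pos p.
  by case: (Pos.to_nat p) => // q _ /=; rewrite addSnnS.
rewrite tlE nth_drop Pos2Nat.inj_xI multE mul2n -addnn.
have /ltP := Pos2Nat.is_pos p.
by case: (Pos.to_nat p) => // q _ /=; rewrite add1n addSnnS.
Qed.

Lemma sum_ord4 (V : nmodType) (F : 'I_4 -> V) :
  \sum_(i < 4) F i = F (ord4 0) + F (ord4 1) + F (ord4 2) + F (ord4 3).
Proof.
rewrite !big_ord_recl big_ord0 addr0 !addrA.
by congr (F _ + F _ + F _ + F _); apply: val_inj.
Qed.

Section FourVariables.
Variables (C : comNzRingType).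

Definition vars4 : seq {mpoly C[4]} :=
  [:: 'X_(ord4 0); 'X_(ord4 1); 'X_(ord4 2); 'X_(ord4 3)].
Definition env4 (y : 'I_4 -> C) : seq C :=
  [:: y (ord4 0); y (ord4 1); y (ord4 2); y (ord4 3)].

Lemma meval_peval (z : C) (y : 'I_4 -> C) e :
  (peval z%:MP vars4 e).@[y] = peval z (env4 y) e.
Proof.
by rewrite -[LHS](peval_rmorph (meval y)) /= !mevalXU mevalC.
Qed.

Definition var4 (k : 'I_4) : positive := Pos.of_succ_nat k.

(** [pderiv] is the formal derivative only on expressions without powers. *)
Lemma mderiv_peval (z : C) (k : 'I_4) e : pow_free e ->
  (peval z%:MP vars4 e)^`M(k) = peval z%:MP vars4 (pderiv (var4 k) e).
Proof.
have mderiv_const c : (ceval (z%:MP : {mpoly C[4]}) c)^`M(k) = 0.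
  by rewrite (ceval_rmorph (@mpolyC 4 C : {rmorphism _ -> _})) mderivC.
elim: e => //= [_|_|j _|a IHa b IHb|a IHa b IHb|a IHa b IHb|a IHa].
- by rewrite -mpolyC0 mderivC.
- by rewrite -mpolyC1 mderivC.
- have -> : Pos.eqb j (var4 k) = ((Pos.to_nat j).-1 == k).
    have kE : (Pos.to_nat (var4 k)).-1 = k by rewrite SuccNat2Pos.id_succ.
    rewrite -[in RHS]kE; apply/idP/eqP => [/Pos.eqb_eq -> //|e].
    apply/Pos.eqb_eq/Pos2Nat.inj.
    have /ltP := Pos2Nat.is_pos j; have /ltP := Pos2Nat.is_pos (var4 k).
    by move: e; case: (Pos.to_nat _) (Pos.to_nat _) => [|p] [|q] //= ->.
  rewrite blnthE; case: (Pos.to_nat j).-1 k {mderiv_const} =>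
    [|[|[|[|q]]]] [[|[|[|[|//]]]] hk] //=; by rewrite ?nth_nil ?(mderivXU, raddf0).
- by case/andP=> /IHa {}IHa /IHb {}IHb; rewrite mderivD IHa IHb.
- by case/andP=> /IHa {}IHa /IHb {}IHb; rewrite mderivB IHa IHb.
- by case/andP=> /IHa {}IHa /IHb {}IHb; rewrite mderivM IHa IHb.
- by move=> /IHa {}IHa; rewrite mderivN IHa.
Qed.

End FourVariables.
Arguments vars4 {C}.

(** * The quartic F *)

Definition psum : seq (PExpr cyc) -> PExpr cyc := foldr (@PEadd cyc) PEO.
Definition pprod : seq (PExpr cyc) -> PExpr cyc := foldr (@PEmul cyc) PEI.

Definition lin (f : seq cyc) : PExpr cyc :=
  psum [seq PEmul (PEc (nth cyc0 f k)) (PEX cyc (Pos.of_succ_nat k)) | k <- iota 0 4].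

(** i = z^2 and b = z + z^3 - 1; b^2 = -1 - 2 (z + z^3). *)
Definition i_coef := Cyc 0 0 1 0.
Definition b_coef := Cyc (-1) 1 0 1.
Definition ib_coef := cyc_mul i_coef b_coef.

(** Coefficients of y0, ..., y3 in l0, ..., l3 and m0, ..., m3. *)
Definition l_forms : seq (seq cyc) :=
  [:: [:: cyc0; cyc0; cyc1; cyc0];
      [:: cyc0; cyc0; cyc0; cyc1];
      [:: ib_coef; b_coef; cyc1; i_coef];
      [:: cyc_opp ib_coef; b_coef; cyc1; cyc_opp i_coef]].
Definition m_forms : seq (seq cyc) :=
  [:: [:: cyc1; cyc0; cyc0; cyc0];
      [:: cyc0; cyc1; cyc0; cyc0];
      [:: i_coef; cyc1; cyc_opp b_coef; cyc_opp ib_coef];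
      [:: cyc_opp i_coef; cyc1; cyc_opp b_coef; ib_coef]].

Definition quartic_expr : PExpr cyc :=
  PEadd (pprod (map lin l_forms)) (pprod (map lin m_forms)).

(** The entry number j in row i of the matrix number q is the coefficient of
    x_i y_j in Q_q. *)
Definition tensor_table : seq (seq (seq cyc)) := [::
  [:: [:: Cyc 0 0 0 0; Cyc 0 0 0 0; Cyc 0 0 0 1; Cyc 0 0 0 0];
      [:: Cyc 1 0 0 0; Cyc 0 0 0 0; Cyc 0 0 0 0; Cyc 0 0 0 0];
      [:: Cyc 0 0 0 0; Cyc 0 0 0 0; Cyc (-1) 0 0 0; Cyc 0 0 0 0];
      [:: Cyc 0 1 0 0; Cyc 0 0 0 0; Cyc 0 0 0 0; Cyc 0 0 0 0]];
  [:: [:: Cyc 0 0 0 0; Cyc 0 0 0 0; Cyc 0 0 0 0; Cyc 0 0 0 (-1)];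
      [:: Cyc 0 0 0 0; Cyc 1 0 0 0; Cyc 0 0 0 0; Cyc 0 0 0 0];
      [:: Cyc 0 0 0 0; Cyc 0 0 0 0; Cyc 0 0 0 0; Cyc 0 0 1 0];
      [:: Cyc 0 0 0 0; Cyc 0 0 0 1; Cyc 0 0 0 0; Cyc 0 0 0 0]];
  [:: [:: Cyc 0 0 0 0; Cyc 1 (-2) (-1) 0; Cyc (-1) 0 1 0; Cyc 0 (-1) 0 (-1)];
      [:: Cyc 1 0 0 0; Cyc 2 0 (-1) 0; Cyc 1 (-1) 0 (-1); Cyc 1 (-1) 0 (-1)];
      [:: Cyc 1 1 (-1) 0; Cyc (-1) (-1) 1 0; Cyc 0 1 0 0; Cyc 1 (-1) 1 0];
      [:: Cyc 0 0 0 0; Cyc 0 0 0 0; Cyc (-2) (-1) 0 (-1); Cyc 0 0 0 0]];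
  [:: [:: Cyc 6 0 0 0; Cyc 0 0 0 0; Cyc (-2) 2 2 0; Cyc (-2) (-2) 0 (-2)];
      [:: Cyc (-1) 2 (-3) (-4); Cyc 1 0 1 2; Cyc 3 0 3 0; Cyc (-3) 0 (-3) 0];
      [:: Cyc 0 (-3) 0 (-3); Cyc 0 (-3) 0 (-3); Cyc (-2) (-1) 2 3; Cyc (-2) 1 0 1];
      [:: Cyc 0 0 0 0; Cyc 0 0 0 0; Cyc 0 0 0 0; Cyc 0 0 0 6]]].

Definition tensor_coef q i j : cyc := nth cyc0 (nth nil (nth nil tensor_table q) i) j.

(** Coefficient p + q (z + z^3): F is defined over the field generated by
    z + z^3, a square root of -2, and so is the certificate below. *)
Definition mono (p q : Z) (e0 e1 e2 e3 : N) : PExpr cyc :=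
  PEmul (PEc (Cyc p q 0 q)) (pprod [:: PEpow (PEX cyc 1) e0;
    PEpow (PEX cyc 2) e1; PEpow (PEX cyc 3) e2; PEpow (PEX cyc 4) e3]).

(** Solution of a linear system: the four cubic derivatives of F form a regular
    sequence, so that all monomials of degree 9 are in their ideal.  The
    monomials used have the parity in y1, y2 that the symmetry
    (y0, -y1, -y2, y3) of F, which changes its sign, imposes. *)
Definition jacobian_cofactors : seq (PExpr cyc) := [::
  psum [::
    mono (-16128) (-3906) 1 0 1 4; mono 13860 (-630) 1 1 0 4;
    mono 26082 (-28350) 2 0 1 3; mono 6356 35896 2 1 0 3;
    mono 23088 36240 3 0 1 2; mono (-57946) 8974 3 1 0 2;
    mono (-48770) 4934 4 0 1 1; mono (-10472) (-18964) 4 1 0 1;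
    mono (-124) (-9626) 5 0 1 0; mono 6790 (-1936) 5 1 0 0];
  psum [::
    mono (-630) 1575 0 0 0 6; mono 1582 2093 0 0 2 4;
    mono (-2912) (-1414) 0 1 1 4; mono 2310 (-105) 0 2 0 4;
    mono (-7602) (-4620) 1 0 0 5; mono (-9198) (-630) 1 0 2 3;
    mono 11998 (-6748) 1 1 1 3; mono 14 5824 1 2 0 3;
    mono 12019 (-5824) 2 0 0 4; mono 11095 (-3775) 2 0 2 2;
    mono (-7272) 5436 2 1 1 2; mono (-5887) (-119) 2 2 0 2;
    mono 7710 4416 3 0 0 3; mono 9902 1282 3 0 2 1;
    mono 20068 (-3100) 3 1 1 1; mono (-556) (-122) 3 2 0 1;
    mono (-1845) 7587 4 0 0 2; mono (-384) 960 4 0 2 0;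
    mono (-4432) 5626 4 1 1 0; mono (-6086) (-3352) 4 2 0 0;
    mono (-8162) (-5002) 5 0 0 1; mono 4608 0 6 0 0 0];
  psum [::
    mono 3696 (-168) 0 0 2 4; mono (-6930) 315 1 0 0 5;
    mono (-3668) 4445 1 0 2 3; mono 1890 (-4725) 1 2 0 3;
    mono (-6762) (-9744) 2 0 0 4; mono 4372 (-5962) 2 0 2 2;
    mono 16870 6398 2 2 0 2; mono 8939 (-8834) 3 0 0 3;
    mono (-2061) 1611 3 0 2 1; mono (-7287) 2247 3 2 0 1;
    mono 11662 1328 4 0 0 2; mono 1894 368 4 0 2 0; mono 6414 3576 4 1 1 0;
    mono (-2086) 3910 4 2 0 0; mono (-4385) 4685 5 0 0 1;
    mono (-6202) (-1814) 6 0 0 0];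
  psum [::
    mono 448 1526 0 0 1 5; mono (-4620) 210 0 1 0 5;
    mono (-16702) 9058 1 0 1 4; mono (-4732) (-22568) 1 1 0 4;
    mono (-12704) (-30880) 2 0 1 3; mono 57862 (-14434) 2 1 0 3;
    mono 57310 (-3658) 3 0 1 2; mono 33288 26940 3 1 0 2;
    mono 2164 22670 4 0 1 1; mono (-11434) 18568 4 1 0 1;
    mono (-4224) 192 5 0 1 0; mono (-1536) (-1344) 5 1 0 0]].

Definition gradient_exprs : seq (PExpr cyc) :=
  [seq pderiv (Pos.of_succ_nat k) quartic_expr | k <- iota 0 4].

Lemma jacobian_certificate :
  same_poly (PEmul (PEc (cyc_int 4608)) (PEpow (PEX cyc 1) 9))
    (combine jacobian_cofactors gradient_exprs).
Proof. by vm_compute. Qed.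

Definition X_ (k : nat) := PEX cyc (Pos.of_succ_nat k).
(** Four substitutions preserving F; the image of y0 runs through the four
    coordinates.  The second component says that the k-th derivative of F
    becomes, after the substitution, a derivative of F up to sign. *)
Definition symmetries : seq (seq (PExpr cyc) * seq (bool * nat)) :=
  [:: ([:: X_ 0; X_ 1; X_ 2; X_ 3],
       [:: (false, 0); (false, 1); (false, 2); (false, 3)]%N);
      ([:: X_ 1; X_ 0; X_ 3; X_ 2],
       [:: (false, 1); (false, 0); (false, 3); (false, 2)]%N);
      ([:: X_ 2; X_ 3; PEopp (X_ 0); PEopp (X_ 1)],
       [:: (false, 2); (false, 3); (true, 0); (true, 1)]%N);
      ([:: X_ 3; X_ 2; PEopp (X_ 1); PEopp (X_ 0)],
       [:: (false, 3); (false, 2); (true, 1); (true, 0)]%N)].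

Definition symmetry_ok (s : seq (PExpr cyc) * seq (bool * nat)) :=
  all (fun k => let: (sg, j) := nth (false, 0%N) s.2 k in
    let d := nth PEO gradient_exprs j in
    same_poly (psubst s.1 (nth PEO gradient_exprs k)) (if sg then PEopp d else d))
  (iota 0 4).

Lemma symmetries_ok : all symmetry_ok symmetries.
Proof. by vm_compute. Qed.

Lemma peval_sum (R : comNzRingType) (z : R) env s :
  peval z env (psum s) = \sum_(e <- s) peval z env e.
Proof. by elim: s => [|e s IH]; rewrite ?big_nil // big_cons -IH. Qed.
Lemma peval_prod (R : comNzRingType) (z : R) env s :
  peval z env (pprod s) = \prod_(e <- s) peval z env e.
Proof. by elim: s => [|e s IH]; rewrite ?big_nil // big_cons -IH. Qed.

Section Quartic.
Variables (C : numFieldType) (z : C).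
Hypothesis z4 : z ^+ 4 = -1.

Definition lpoly (f : seq cyc) : {mpoly C[4]} :=
  \sum_(k < 4) ceval z (nth cyc0 f k) *: 'X_k.
Definition lval (f : seq cyc) (y : 'rV[C]_4) : C :=
  \sum_(k < 4) ceval z (nth cyc0 f k) * y 0 k.

Definition quartic : {mpoly C[4]} :=
  \prod_(f <- l_forms) lpoly f + \prod_(f <- m_forms) lpoly f.

Lemma lpoly_eval f (y : 'rV[C]_4) : (lpoly f).@[y 0] = lval f y.
Proof.
rewrite /lpoly (raddf_sum (meval _)) /=.
by apply: eq_bigr => k _; rewrite mevalZ mevalXU.
Qed.

Definition qval (y : 'rV[C]_4) : C :=
  \prod_(f <- l_forms) lval f y + \prod_(f <- m_forms) lval f y.

Lemma quartic_eval (y : 'rV[C]_4) : quartic.@[y 0] = qval y.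
Proof.
rewrite mevalD !(rmorph_prod (meval _)) /=.
by congr (_ + _); apply: eq_bigr => f _; rewrite lpoly_eval.
Qed.

Lemma dhomog_lpoly f : lpoly f \is 1.-homog.
Proof. by apply: rpred_sum => k _; apply: rpredZ; rewrite dhomogX /= mdeg1. Qed.

Lemma quartic_homog : quartic \is 4.-homog.
Proof.
rewrite /quartic !big_cons !big_nil !mulr1.
by apply: rpredD; do 3![apply: (@dhomogM _ _ _ 1 _ _ _ (dhomog_lpoly _))];
  apply: dhomog_lpoly.
Qed.

Lemma lpoly_expr f : lpoly f = peval z%:MP vars4 (lin f).
Proof.
have ceval_mp c : ceval (z%:MP : {mpoly C[4]}) c = (ceval z c)%:MP.
  exact: (ceval_rmorph (@mpolyC 4 C : {rmorphism _ -> _})).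
rewrite /lpoly !big_ord_recl big_ord0 /lin peval_sum /= !big_cons big_nil.
do 4!(congr (_ + _); first by rewrite -mul_mpolyC -ceval_mp /=; congr (_ * 'X_ _); apply: val_inj).
Qed.

Lemma quartic_exprE : quartic = peval z%:MP vars4 quartic_expr.
Proof.
rewrite /quartic_expr [RHS](_ : _ = peval z%:MP vars4 (pprod (map lin l_forms)) +
  peval z%:MP vars4 (pprod (map lin m_forms))) // !peval_prod !big_map.
by congr (_ + _); apply: eq_bigr => f _; rewrite lpoly_expr.
Qed.

Lemma quartic_gradient (k : 'I_4) (y : 'rV[C]_4) :
  (quartic^`M(k)).@[y 0] = peval z (env4 (y 0)) (nth PEO gradient_exprs k).
Proof.
rewrite quartic_exprE mderiv_peval // meval_peval; congr peval.
by case: k => -[|[|[|[|]]]].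
Qed.

(** At a singular point the four derivatives vanish after each substitution as
    well, so the certificate gives y_k^9 = 0 for every k. *)
Lemma quartic_smooth (y : 'rV[C]_4) : y != 0 -> quartic.@[y 0] = 0 ->
  exists k, (quartic^`M(k)).@[y 0] != 0.
Proof.
move=> y0 _; apply: contrapT => sing; case/eqP: y0.
have grad0 k : (k < 4)%N -> peval z (env4 (y 0)) (nth PEO gradient_exprs k) = 0.
  move=> k4; apply/eqP; apply: contrapT => /negP nz; apply: sing.
  by exists (Ordinal k4); rewrite quartic_gradient.
have first0 i : (i < size symmetries)%N ->
  peval z (env4 (y 0)) (nth PEO (nth (nil, nil) symmetries i).1 0) = 0.
  move=> hi; have := all_nthP (nil, nil) symmetries_ok i hi.
  set s := nth _ symmetries i => /allP ok.
  have sz : (size s.1 = 4)%N by move: hi @s {ok}; case: i => [|[|[|[|]]]].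
  pose env := [seq peval z (env4 (y 0)) e | e <- s.1].
  suff : peval z env (PEmul (PEc (cyc_int 4608)) (PEpow (PEX cyc 1) 9)) = 0.
    have -> : peval z env (PEmul (PEc (cyc_int 4608)) (PEpow (PEX cyc 1) 9)) =
      ceval z (cyc_int 4608) * BinList.nth 0 1 env ^+ N.to_nat 9 by [].
    move=> /eqP; rewrite mulf_eq0 (negPf (ceval_neq0 z4 _)) //.
    by rewrite expf_eq0 => /andP[_ /eqP]; rewrite /env; case: (s.1) sz.
  apply: (ideal_member (cofactors := jacobian_cofactors) (gens := gradient_exprs) z4).
    exact: jacobian_certificate.
  move=> k hk; rewrite -peval_subst.
  have := ok k; rewrite mem_iota => /(_ hk).
  case: (nth _ s.2 k) => sg j /(same_polyP z4 (env4 (y 0))) ->.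
  have gj : peval z (env4 (y 0)) (nth PEO gradient_exprs j) = 0.
    have [/grad0 //|le4j] := ltnP j 4; by rewrite nth_default.
  by case: sg; rewrite //= [peval _ _ _]gj oppr0.
apply/rowP => k; rewrite mxE.
have := first0 k; case: k => -[|[|[|[|//]]]] hk /(_ hk) /= e;
  rewrite -[RHS]e; congr (y 0 _); exact: val_inj.
Qed.
End Quartic.

(** * The two determinants *)

(** Laplace expansion with abstract operations, so that the same formula gives a
    determinant of ring elements and an expression to be normalized. *)
Section Det4.
Variables (T : Type) (add sub mul : T -> T -> T) (f : nat -> nat -> T).
Definition minor2 c d := sub (mul (f 2 c) (f 3 d)) (mul (f 2 d) (f 3 c)).
Definition minor3 b c d :=
  add (sub (mul (f 1 b) (minor2 c d)) (mul (f 1 c) (minor2 b d)))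
      (mul (f 1 d) (minor2 b c)).
Definition det4 :=
  sub (add (sub (mul (f 0 0) (minor3 1 2 3)) (mul (f 0 1) (minor3 0 2 3)))
           (mul (f 0 2) (minor3 0 1 3)))
      (mul (f 0 3) (minor3 0 1 2)).
End Det4.

Lemma det4E (R : comNzRingType) (f : nat -> nat -> R) :
  \det (\matrix_(i < 4, j < 4) f i j) = det4 +%R (fun x y => x - y) *%R f.
Proof.
rewrite (expand_det_row _ ord0) !big_ord_recl big_ord0 /cofactor.
rewrite !(expand_det_row _ ord0) !big_ord_recl !big_ord0 /cofactor.
rewrite !(expand_det_row _ ord0) !big_ord_recl !big_ord0 /cofactor.
rewrite !det_mx11 !mxE /= /det4 /minor3 /minor2 /bump /=.
by rewrite !(addn0, add0n, addn1, add1n) /=; ring.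
Qed.

(** The constant c = -6 - 6 z^2 + 12 z^3. *)
Definition det_scale := Cyc (-6) 0 (-6) 12.

Definition tensor_det (coef : nat -> nat -> nat -> cyc) : PExpr cyc :=
  det4 (@PEadd cyc) (@PEsub cyc) (@PEmul cyc)
    (fun q j => lin [seq coef q i j | i <- iota 0 4]).

Definition fermat_expr : PExpr cyc :=
  psum [seq pprod (nseq 4 (X_ k)) | k <- iota 0 4].

Lemma tensor_det_fermat :
  same_poly (tensor_det tensor_coef) (PEmul (PEc det_scale) fermat_expr).
Proof. by vm_compute. Qed.

Lemma tensor_det_quartic :
  same_poly (tensor_det (fun q i j => tensor_coef q j i))
    (PEmul (PEc det_scale) quartic_expr).
Proof. by vm_compute. Qed.

Section Tensor.
Variables (C : numFieldType) (z : C).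
Hypothesis z4 : z ^+ 4 = -1.

Let Z4 : (z%:MP : {mpoly C[4]}) ^+ 4 = -1.
Proof. by rewrite -rmorphXn z4 rmorphN1. Qed.

Definition tensor (q : 'I_4) : 'M[C]_4 :=
  \matrix_(i, j) ceval z (tensor_coef q i j).

Lemma det_formmx (coef : nat -> nat -> nat -> cyc) :
  \det (formmx (fun q : 'I_4 => \matrix_(i < 4, j < 4) ceval z (coef q i j)))
  = peval z%:MP vars4 (tensor_det coef).
Proof.
rewrite [RHS](_ : _ = det4 +%R (fun x y => x - y) *%R (fun q j =>
  peval z%:MP vars4 (lin [seq coef q i j | i <- iota 0 4]))) // -det4E.
congr (\det _); apply/matrixP => q j; rewrite !mxE -lpoly_expr.
apply: eq_bigr => i _; rewrite mxE (nth_map 0%N) ?size_iota //.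
by rewrite nth_iota.
Qed.

Lemma fermat_exprE : fermat_quartic C = peval z%:MP vars4 fermat_expr.
Proof.
rewrite /fermat_expr peval_sum big_map -[iota 0 4]/(index_iota 0 4) big_mkord.
apply: eq_bigr => i _; rewrite peval_prod big_nseq iter_mulr_1; congr (_ ^+ _).
by case: i => -[|[|[|[|//]]]] hi; congr 'X_ _; apply: val_inj.
Qed.

Lemma det_tensor : \det (formmx tensor) = ceval z det_scale *: fermat_quartic C.
Proof.
rewrite det_formmx (same_polyP Z4 _ tensor_det_fermat) -mul_mpolyC fermat_exprE.
congr (_ * _); exact: (ceval_rmorph (@mpolyC 4 C : {rmorphism _ -> _})).
Qed.

Lemma det_tensor_tr :
  \det (formmx (fun q => (tensor q)^T)) = ceval z det_scale *: quartic z.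
Proof.
rewrite (_ : (fun q => _) = fun q : 'I_4 =>
  \matrix_(i, j) ceval z (tensor_coef q j i)); last first.
  by apply: funext => q; apply/matrixP => i j; rewrite !mxE.
rewrite (det_formmx (fun q i j => tensor_coef q j i)).
rewrite (same_polyP Z4 _ tensor_det_quartic) -mul_mpolyC quartic_exprE.
congr (_ * _); exact: (ceval_rmorph (@mpolyC 4 C : {rmorphism _ -> _})).
Qed.

Lemma det_scale_neq0 : ceval z det_scale != 0.
Proof. exact: ceval_neq0. Qed.

Lemma fermat_smooth (x : 'rV[C]_4) : x != 0 -> (fermat_quartic C).@[x 0] = 0 ->
  exists k, ((fermat_quartic C)^`M(k)).@[x 0] != 0.
Proof.
move=> x0 _; apply: contrapT => sing; case/eqP: x0; apply/rowP => k; rewrite mxE.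
apply/eqP; apply: contrapT => /negP xk; apply: sing; exists k.
rewrite /fermat_quartic (raddf_sum (mderiv _)) (raddf_sum (meval _)) /=.
rewrite (bigD1 k) //= big1 ?addr0 => [|i ik].
  rewrite !exprS expr0 !mderivM !mderivXU -mpolyC1 mderivC.
  rewrite eqxx !(mevalD, mevalM, mevalXU, mevalC, rmorph_nat, meval0) /=.
  have -> : 1 * (x 0 k * (x 0 k * (x 0 k * 1))) + x 0 k *
    (1 * (x 0 k * (x 0 k * 1)) + x 0 k * (1 * (x 0 k * 1) +
      x 0 k * (1 * 1 + x 0 k * 0))) = 4 * x 0 k ^+ 3 by ring.
  by rewrite mulf_neq0 ?expf_neq0 // pnatr_eq0.
rewrite !exprS expr0 !mderivM !mderivXU -mpolyC1 mderivC (negPf ik).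
by rewrite !(mul0r, mulr0, addr0) meval0.
Qed.

(** The point (1, z, 0, 0). *)
Lemma X48_neq0 : X48 C !=set0.
Proof.
pose v : 'rV[C]_4 := \row_k nth 0 [:: 1; z] k.
have v0 : v != 0.
  by apply/eqP => /rowP/(_ 0); rewrite !mxE /= => /eqP; rewrite oner_eq0.
have Fv : (fermat_quartic C).@[v 0] = 0.
  rewrite /fermat_quartic (raddf_sum (meval _)) /= !big_ord_recl big_ord0.
  rewrite !(rmorphXn (meval _)) /= !mevalXU !mxE /= z4.
  by rewrite expr1n expr0n /= !addr0 subrr.
exists (pt_of v0) => f ->; rewrite coordsE; apply/eqP.
rewrite -(dhomog_root (d := 4)) ?Fv //.
by apply: rpred_sum => k _; apply: (@dhomogMn _ _ _ 1 _ 4); rewrite dhomogX /= mdeg1.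
Qed.

Lemma QsE : Qs z = bilinear_system tensor.
Proof.
(* an opaque ring morphism keeps the scalars out of the way of ring *)
have [f fE] : exists f : {rmorphism C -> {mpoly C[4 + 4]}}, forall c p, c *: p = f c * p.
  by exists (@mpolyC 8 C) => c p; rewrite mul_mpolyC.
apply: eq_from_tnth => q; rewrite tnth_mktuple /bilinear_form.
case: q => -[|[|[|[|//]]]] hq; rewrite !sum_ord4 !mxE /tnth /= /zeval /= /Pos.to_nat /=;
  by rewrite /Q0 /Q1 /Q2 /Q3 !fE {fE}; ring.
Qed.
End Tensor.

(** * Data for the lines off the eight planes *)

(** The automorphism z -> z^3, which fixes b and sends i to -i; on the linear
    forms it exchanges l2 with l3 and m2 with m3. *)
Definition cyc_galois '(Cyc a b c d) : cyc := Cyc a d (Z.opp c) b.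

Definition mono2 (c : cyc) (x y : nat) := (c, x, y).
Definition mono2_expr (t : cyc * nat * nat) : PExpr cyc :=
  let: (c, x, y) := t in
  PEmul (PEc c) (PEmul (PEpow (X_ 0) (N.of_nat x)) (PEpow (X_ 1) (N.of_nat y))).

(** A pair (i, j) = [pair_l] with the remaining indices (k, h) = [pair_rest].
    The forms l_i, l_j, m0, m1 are coordinates; the rows of [pair_frame] express
    2 l_k, 2 l_h and the doubles of m2, m3 in
    these coordinates.  With D = [pair_den], the lines are
    D m0 = beta l_i, D m1 = alpha l_j for the pairs (alpha, beta) in
    [pair_sols], which have integral entries.  The cofactors show that
    [root_scale] times a monomial in alpha and beta, with exponents
    [root_shift], times the product of the alpha - alpha_s over all solutions s
    is in the ideal of the equations for (alpha, beta). *)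
Record skew_pair := SkewPair {
  pair_l : nat * nat;
  pair_rest : nat * nat;
  pair_den : Z;
  pair_frame : seq (seq cyc);
  pair_sols : seq (cyc * cyc);
  root_shift : nat * nat;
  root_scale : Z;
  root_cofactors : seq (seq (cyc * nat * nat)) }.

(** Solutions found by elimination, cofactors by linear algebra.  The first two
    pairs are preserved by the automorphism z -> z^3, the others stand for
    two pairs each. *)
Definition base_pairs : seq skew_pair := [::
  {| pair_l := (0, 1)%N; pair_rest := (2, 3)%N; pair_den := 1;
     pair_frame := [:: [:: Cyc 2 0 0 0; Cyc 0 0 2 0; Cyc 0 (-2) (-2) 2; Cyc (-2) 2 0 2];
       [:: Cyc 2 0 0 0; Cyc 0 0 (-2) 0; Cyc 0 2 2 (-2); Cyc (-2) 2 0 2];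
       [:: Cyc 2 (-2) 0 (-2); Cyc 0 2 2 (-2); Cyc 0 0 2 0; Cyc 2 0 0 0];
       [:: Cyc 2 (-2) 0 (-2); Cyc 0 (-2) (-2) 2; Cyc 0 0 (-2) 0; Cyc 2 0 0 0]];
     pair_sols := [:: (Cyc (-1) 0 0 0, Cyc 1 0 0 0); (Cyc 0 0 (-1) 0, Cyc 0 0 1 0);
       (Cyc 0 0 1 0, Cyc 0 0 (-1) 0); (Cyc 1 0 0 0, Cyc (-1) 0 0 0)];
     root_shift := (0, 1)%N; root_scale := 96;
     root_cofactors :=
      [:: [:: mono2 (Cyc (-12) 0 0 0) 0 1; mono2 (Cyc 0 6 0 6) 1 0];
      [:: mono2 (Cyc 2 2 0 2) 0 0; mono2 (Cyc (-4) (-1) 0 (-1)) 1 1;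
          mono2 (Cyc 6 3 0 3) 2 0];
      [:: mono2 (Cyc 12 (-6) 0 (-6)) 1 0]] |};
  {| pair_l := (1, 0)%N; pair_rest := (2, 3)%N; pair_den := 3;
     pair_frame := [:: [:: Cyc 0 0 2 0; Cyc 2 0 0 0; Cyc 0 (-2) (-2) 2; Cyc (-2) 2 0 2];
       [:: Cyc 0 0 (-2) 0; Cyc 2 0 0 0; Cyc 0 2 2 (-2); Cyc (-2) 2 0 2];
       [:: Cyc 0 2 2 (-2); Cyc 2 (-2) 0 (-2); Cyc 0 0 2 0; Cyc 2 0 0 0];
       [:: Cyc 0 (-2) (-2) 2; Cyc 2 (-2) 0 (-2); Cyc 0 0 (-2) 0; Cyc 2 0 0 0]];
     pair_sols := [:: (Cyc 0 0 (-3) 0, Cyc 0 0 3 0); (Cyc 0 0 3 0, Cyc 0 0 (-3) 0);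
       (Cyc (-3) (-3) 0 3, Cyc (-3) (-3) 0 3);
       (Cyc (-3) 3 0 (-3), Cyc (-3) 3 0 (-3));
       (Cyc 0 3 (-3) 3, Cyc 0 3 (-3) 3); (Cyc 0 3 3 3, Cyc 0 3 3 3);
       (Cyc 3 3 0 3, Cyc (-1) 1 0 1); (Cyc (-1) 1 0 1, Cyc 3 3 0 3)];
     root_shift := (0, 1)%N; root_scale := 864;
     root_cofactors :=
      [:: [:: mono2 (Cyc (-17496) 0 0 0) 0 1; mono2 (Cyc (-16038) 729 0 729) 1 0;
          mono2 (Cyc 5832 (-18954) 0 (-18954)) 1 1;
          mono2 (Cyc 162 (-405) 0 (-405)) 1 2;
          mono2 (Cyc (-7776) (-6804) 0 (-6804)) 2 0;
          mono2 (Cyc 16200 3240 0 3240) 2 1; mono2 (Cyc 648 324 0 324) 2 2;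
          mono2 (Cyc 972 (-2430) 0 (-2430)) 3 0;
          mono2 (Cyc (-648) 3564 0 3564) 3 1; mono2 (Cyc (-252) 198 0 198) 3 2;
          mono2 (Cyc 432 (-108) 0 (-108)) 4 0;
          mono2 (Cyc (-864) 216 0 216) 4 1;
          mono2 (Cyc (-72) (-36) 0 (-36)) 4 2; mono2 (Cyc 18 9 0 9) 5 0;
          mono2 (Cyc (-48) (-42) 0 (-42)) 5 1; mono2 (Cyc 2 (-5) 0 (-5)) 5 2];
      [::];
      [:: mono2 (Cyc 16038 (-729) 0 (-729)) 1 0;
          mono2 (Cyc (-1944) 17982 0 17982) 2 0;
          mono2 (Cyc (-17334) (-405) 0 (-405)) 3 0;
          mono2 (Cyc (-864) (-4644) 0 (-4644)) 4 0;
          mono2 (Cyc 1314 (-423) 0 (-423)) 5 0; mono2 (Cyc 120 78 0 78) 6 0;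
          mono2 (Cyc (-2) 5 0 5) 7 0]] |};
  {| pair_l := (0, 2)%N; pair_rest := (1, 3)%N; pair_den := 4;
     pair_frame := [:: [:: Cyc 0 0 2 0; Cyc 0 0 (-2) 0; Cyc 2 (-2) 0 (-2); Cyc 0 (-2) (-2) 2];
       [:: Cyc 4 0 0 0; Cyc (-2) 0 0 0; Cyc 0 0 0 0; Cyc (-4) 4 0 4];
       [:: Cyc 0 0 0 0; Cyc 2 (-2) 0 (-2); Cyc 0 4 0 (-4); Cyc 0 (-4) 0 (-4)];
       [:: Cyc 4 (-4) 0 (-4); Cyc (-2) 2 0 2; Cyc 0 (-4) 0 4; Cyc 4 4 0 4]];
     pair_sols := [:: (Cyc (-1) (-1) (-1) (-1), Cyc 0 0 0 (-4));
       (Cyc (-1) (-1) 1 (-1), Cyc 0 4 0 0)];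
     root_shift := (0, 0)%N; root_scale := 49152;
     root_cofactors :=
      [:: [:: mono2 (Cyc 0 96 576 (-96)) 0 0; mono2 (Cyc 16 (-64) 0 (-64)) 0 1;
          mono2 (Cyc 0 8 (-4) (-8)) 0 2; mono2 (Cyc (-4) 1 0 1) 0 3;
          mono2 (Cyc (-24) 48 0 48) 1 1; mono2 (Cyc 0 18 (-18) (-18)) 1 2];
      [:: mono2 (Cyc 0 16 192 (-16)) 0 0; mono2 (Cyc (-16) 4 0 4) 0 1;
          mono2 (Cyc 0 4 (-8) (-4)) 0 2; mono2 (Cyc 0 64 32 (-64)) 1 0;
          mono2 (Cyc (-8) 34 0 34) 1 1; mono2 (Cyc 0 (-1) (-2) 1) 1 2;
          mono2 (Cyc 14 8 0 8) 2 1];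
      [:: mono2 (Cyc 0 24 0 (-24)) 0 0; mono2 (Cyc 0 18 0 18) 0 1;
          mono2 (Cyc 0 (-4) (-64) 4) 1 0; mono2 (Cyc 10 5 0 5) 1 1;
          mono2 (Cyc 0 (-18) (-12) 18) 2 0]] |};
  {| pair_l := (1, 2)%N; pair_rest := (0, 3)%N; pair_den := 4;
     pair_frame := [:: [:: Cyc 0 0 (-2) 0; Cyc 2 0 0 0; Cyc 0 2 2 (-2); Cyc 2 (-2) 0 (-2)];
       [:: Cyc 0 0 (-4) 0; Cyc 2 0 0 0; Cyc 0 4 4 (-4); Cyc 0 0 0 0];
       [:: Cyc 0 0 0 0; Cyc 2 (-2) 0 (-2); Cyc 0 4 0 (-4); Cyc 0 (-4) 0 (-4)];
       [:: Cyc 0 (-4) (-4) 4; Cyc 2 (-2) 0 (-2); Cyc 0 4 (-4) (-4); Cyc 0 (-4) 0 (-4)]];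
     pair_sols := [:: (Cyc (-1) (-1) (-1) (-1), Cyc 0 4 (-4) 4);
       (Cyc (-1) (-1) 1 (-1), Cyc 0 4 4 4)];
     root_shift := (2, 1)%N; root_scale := 1536;
     root_cofactors :=
      [:: [:: mono2 (Cyc (-288) (-48) 0 (-48)) 0 0;
          mono2 (Cyc 120 (-84) 0 (-84)) 0 1; mono2 (Cyc 6 12 0 12) 0 2;
          mono2 (Cyc (-48) 0 0 0) 1 0; mono2 (Cyc (-12) 12 0 12) 1 1;
          mono2 (Cyc (-3) (-6) 0 (-6)) 1 2];
      [:: mono2 (Cyc 0 (-32) 176 32) 0 0; mono2 (Cyc 0 (-24) (-36) 24) 0 1;
          mono2 (Cyc 0 24 48 (-24)) 1 0; mono2 (Cyc 0 (-6) 12 6) 1 1;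
          mono2 (Cyc 0 3 0 (-3)) 2 1];
      [:: mono2 (Cyc 120 24 0 24) 0 0; mono2 (Cyc 60 (-42) 0 (-42)) 1 0;
          mono2 (Cyc (-6) (-12) 0 (-12)) 2 0]] |};
  {| pair_l := (2, 0)%N; pair_rest := (1, 3)%N; pair_den := 4;
     pair_frame := [:: [:: Cyc 0 0 (-2) 0; Cyc 0 0 2 0; Cyc 2 (-2) 0 (-2); Cyc 0 (-2) (-2) 2];
       [:: Cyc (-2) 0 0 0; Cyc 4 0 0 0; Cyc 0 0 0 0; Cyc (-4) 4 0 4];
       [:: Cyc 2 (-2) 0 (-2); Cyc 0 0 0 0; Cyc 0 4 0 (-4); Cyc 0 (-4) 0 (-4)];
       [:: Cyc (-2) 2 0 2; Cyc 4 (-4) 0 (-4); Cyc 0 (-4) 0 4; Cyc 4 4 0 4]];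
     pair_sols := [:: (Cyc 0 4 (-4) 4, Cyc (-1) (-1) 1 1); (Cyc 0 4 4 4, Cyc 1 (-1) 1 1)];
     root_shift := (0, 1)%N; root_scale := 1536;
     root_cofactors :=
      [:: [:: mono2 (Cyc 24 (-24) 0 (-24)) 0 0; mono2 (Cyc 0 (-12) 24 12) 0 1;
          mono2 (Cyc (-12) 0 0 0) 0 2; mono2 (Cyc 0 (-3) (-12) 3) 1 1;
          mono2 (Cyc 3 (-3) 0 (-3)) 1 2];
      [:: mono2 (Cyc 16 16 0 16) 0 0; mono2 (Cyc 0 (-16) 16 16) 0 1;
          mono2 (Cyc (-4) 8 0 8) 1 0; mono2 (Cyc 0 (-2) (-16) 2) 1 1;
          mono2 (Cyc 0 2 1 (-2)) 2 1];
      [:: mono2 (Cyc 0 96 0 96) 0 0; mono2 (Cyc (-72) (-24) 0 (-24)) 1 0;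
          mono2 (Cyc 6 (-6) 0 (-6)) 2 0]] |};
  {| pair_l := (2, 1)%N; pair_rest := (0, 3)%N; pair_den := 4;
     pair_frame := [:: [:: Cyc 2 0 0 0; Cyc 0 0 (-2) 0; Cyc 0 2 2 (-2); Cyc 2 (-2) 0 (-2)];
       [:: Cyc 2 0 0 0; Cyc 0 0 (-4) 0; Cyc 0 4 4 (-4); Cyc 0 0 0 0];
       [:: Cyc 2 (-2) 0 (-2); Cyc 0 0 0 0; Cyc 0 4 0 (-4); Cyc 0 (-4) 0 (-4)];
       [:: Cyc 2 (-2) 0 (-2); Cyc 0 (-4) (-4) 4; Cyc 0 4 (-4) (-4); Cyc 0 (-4) 0 (-4)]];
     pair_sols := [:: (Cyc 0 (-4) 0 0, Cyc 1 (-1) 1 1); (Cyc 0 0 0 4, Cyc (-1) (-1) 1 1)];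
     root_shift := (0, 0)%N; root_scale := 6144;
     root_cofactors :=
      [:: [:: mono2 (Cyc 352 (-64) 0 (-64)) 0 0; mono2 (Cyc 0 216 168 (-216)) 0 1;
          mono2 (Cyc 4 62 0 62) 0 2; mono2 (Cyc 0 (-9) 0 9) 0 3;
          mono2 (Cyc 4 (-4) 0 (-4)) 1 1; mono2 (Cyc 0 2 (-1) (-2)) 1 2];
      [:: mono2 (Cyc 0 32 352 (-32)) 0 0; mono2 (Cyc (-96) 24 0 24) 0 1;
          mono2 (Cyc 0 12 (-48) (-12)) 0 2; mono2 (Cyc (-56) 88 0 88) 1 0;
          mono2 (Cyc 0 (-40) 24 40) 1 1; mono2 (Cyc 2 (-4) 0 (-4)) 1 2;
          mono2 (Cyc 0 1 0 1) 2 1];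
      [:: mono2 (Cyc (-256) (-32) 0 (-32)) 0 0; mono2 (Cyc 0 144 0 (-144)) 0 1;
          mono2 (Cyc 0 (-128) (-128) 128) 1 0; mono2 (Cyc 48 48 0 48) 1 1;
          mono2 (Cyc (-24) (-36) 0 (-36)) 2 0]] |};
  {| pair_l := (2, 3)%N; pair_rest := (0, 1)%N; pair_den := 4;
     pair_frame := [:: [:: Cyc 1 0 0 0; Cyc 1 0 0 0; Cyc 0 0 0 0; Cyc 2 (-2) 0 (-2)];
       [:: Cyc 0 0 (-1) 0; Cyc 0 0 1 0; Cyc 2 (-2) 0 (-2); Cyc 0 0 0 0];
       [:: Cyc 2 (-2) 0 (-2); Cyc 0 0 0 0; Cyc 0 4 0 (-4); Cyc 0 (-4) 0 (-4)];
       [:: Cyc 0 0 0 0; Cyc 2 (-2) 0 (-2); Cyc 0 (-4) 0 4; Cyc 0 (-4) 0 (-4)]];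
     pair_sols := [:: (Cyc (-2) 0 0 0, Cyc 0 0 2 0); (Cyc 0 (-1) 0 (-1), Cyc 0 (-1) 0 1);
       (Cyc (-1) (-1) (-1) (-1), Cyc (-1) (-1) 1 (-1));
       (Cyc (-1) (-1) 1 (-1), Cyc 1 1 1 1);
       (Cyc (-1) (-1) 1 1, Cyc 1 (-1) 1 1);
       (Cyc (-1) 1 (-1) (-1), Cyc (-1) (-1) 1 1)];
     root_shift := (0, 1)%N; root_scale := 96;
     root_cofactors :=
      [:: [:: mono2 (Cyc 0 (-6) 0 6) 0 1; mono2 (Cyc 0 (-3) 6 3) 1 1;
          mono2 (Cyc (-6) (-3) 0 (-3)) 2 0; mono2 (Cyc (-3) 0 0 0) 3 0];
      [:: mono2 (Cyc 0 (-6) 0 (-6)) 1 0; mono2 (Cyc (-8) (-5) 0 (-5)) 2 0;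
          mono2 (Cyc (-3) 0 0 0) 3 0];
      [::]] |}].

Definition swap23 k := nth 0%N [:: 0; 1; 3; 2]%N k.
Definition galois_pair (p : skew_pair) : skew_pair :=
  {| pair_l := (swap23 (pair_l p).1, swap23 (pair_l p).2);
     pair_rest := (swap23 (pair_rest p).1, swap23 (pair_rest p).2);
     pair_den := pair_den p;
     pair_frame := [seq map cyc_galois (nth nil (pair_frame p) k) | k <- [:: 0; 1; 3; 2]%N];
     pair_sols := [seq (cyc_galois s.1, cyc_galois s.2) | s <- pair_sols p];
     root_shift := root_shift p;
     root_scale := root_scale p;
     root_cofactors :=
       [seq [seq (cyc_galois t.1.1, t.1.2, t.2) | t <- c] | c <- root_cofactors p] |}.

Definition skew_pairs : seq skew_pair := base_pairs ++ map galois_pair (drop 2 base_pairs).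

Definition lform k := nth nil l_forms k.
Definition mform k := nth nil m_forms k.
Definition lcomb (c : cyc) (f : seq cyc) (d : cyc) (g : seq cyc) : seq cyc :=
  [seq cyc_add (cyc_mul c (nth cyc0 f k)) (cyc_mul d (nth cyc0 g k)) | k <- iota 0 4].
Definition form_eqb (f g : seq cyc) : bool :=
  all (fun k => cyc_eqb (nth cyc0 f k) (nth cyc0 g k)) (iota 0 4).

Section PairExpressions.
Variable p : skew_pair.
Let D := cyc_int (pair_den p).
Let lam k c := nth cyc0 (nth nil (pair_frame p) k) c.
(** For v with coordinates l_j(v) = x, l_i(v) = y, D m0(v) = beta y and
    D m1(v) = alpha x, the value at v of 2 D times the k-th of the forms l_k, l_h,
    m2, m3 is [xpart k] x + [ypart k] y. *)
Definition xpart (k : nat) (al : PExpr cyc) : PExpr cyc :=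
  PEadd (PEc (cyc_mul D (lam k 1))) (PEmul (PEc (lam k 3)) al).
Definition ypart (k : nat) (be : PExpr cyc) : PExpr cyc :=
  PEadd (PEc (cyc_mul D (lam k 0))) (PEmul (PEc (lam k 2)) be).
(** Coefficients of x^2, x y, y^2 in the quotient by x y of the restriction of F
    to the line, up to the factor 4 D^4; see [residual]. *)
Definition line_eqs : seq (PExpr cyc) :=
  let al := X_ 0 in let be := X_ 1 in
  let comb a b c d := PEadd (PEmul (PEc (cyc_mul D D)) (PEmul a b))
                            (PEmul (PEmul al be) (PEmul c d)) in
  [:: comb (xpart 0 al) (xpart 1 al) (xpart 2 al) (xpart 3 al);
      PEadd (comb (xpart 0 al) (ypart 1 be) (xpart 2 al) (ypart 3 be))
            (comb (ypart 0 be) (xpart 1 al) (ypart 2 be) (xpart 3 al));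
      comb (ypart 0 be) (ypart 1 be) (ypart 2 be) (ypart 3 be)].

Definition frame_ok : bool :=
  let fs := [:: lform (pair_rest p).1; lform (pair_rest p).2; mform 2; mform 3] in
  all (fun k => form_eqb (lcomb (cyc_int 2) (nth nil fs k) cyc0 nil)
    (lcomb cyc1 (lcomb (lam k 0) (lform (pair_l p).1) (lam k 1) (lform (pair_l p).2))
           cyc1 (lcomb (lam k 2) (mform 0) (lam k 3) (mform 1)))) (iota 0 4).

Definition roots_ok : bool :=
  same_poly
    (PEmul (PEmul (PEc (cyc_int (root_scale p)))
             (mono2_expr (mono2 cyc1 (root_shift p).1 (root_shift p).2)))
      (pprod [seq PEsub (X_ 0) (PEc s.1) | s <- pair_sols p]))
    (combine [seq psum (map mono2_expr c) | c <- root_cofactors p] line_eqs).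

(** At alpha = alpha_s the first equation is linear in beta, because beta occurs
    there only through the product alpha beta; its leading coefficient [v] has
    to be nonzero and its root to be beta_s. *)
Definition sol_ok (s : cyc * cyc) : bool :=
  let A k := cyc_add (cyc_mul D (lam k 1)) (cyc_mul (lam k 3) s.1) in
  let v := cyc_mul s.1 (cyc_mul (A 2) (A 3)) in
  [&& cyc_nz v,
      same_poly (psubst [:: PEc s.1; X_ 1] (nth PEO line_eqs 0))
                (PEmul (PEc v) (PEsub (X_ 1) (PEc s.2))) &
      all (fun e => same_poly (psubst [:: PEc s.1; PEc s.2] e) PEO) line_eqs].

Definition pair_ok : bool :=
  let: (i, j) := pair_l p in let: (k, h) := pair_rest p in
  [&& perm_eq [:: i; j; k; h] (iota 0 4), cyc_nz D, cyc_nz (cyc_int (root_scale p)),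
      frame_ok, roots_ok & all sol_ok (pair_sols p)].
End PairExpressions.

Lemma pairs_ok : all pair_ok skew_pairs.
Proof. by vm_compute. Qed.

Definition pair_line (p : skew_pair) (s : cyc * cyc) : seq cyc * seq cyc :=
  (lcomb (cyc_int (pair_den p)) (mform 0) (cyc_opp s.2) (lform (pair_l p).1),
   lcomb (cyc_int (pair_den p)) (mform 1) (cyc_opp s.1) (lform (pair_l p).2)).

Definition line_data : seq (seq cyc * seq cyc) :=
  [seq (f, g) | f <- l_forms, g <- m_forms] ++
  flatten [seq [seq pair_line p s | s <- pair_sols p] | p <- skew_pairs].

Lemma size_line_data : size line_data = 56%N.
Proof. by vm_compute. Qed.

Definition cyc_dot (f v : seq cyc) : cyc :=
  foldr cyc_add cyc0 [seq cyc_mul (nth cyc0 f k) (nth cyc0 v k) | k <- iota 0 4].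
Definition minor (fg : seq cyc * seq cyc) (a b : nat) : cyc :=
  cyc_sub (cyc_mul (nth cyc0 fg.1 a) (nth cyc0 fg.2 b))
          (cyc_mul (nth cyc0 fg.1 b) (nth cyc0 fg.2 a)).
Definition line_indep (fg : seq cyc * seq cyc) : bool :=
  has (fun ab => cyc_nz (minor fg ab.1 ab.2)) [seq (a, b) | a <- iota 0 4, b <- iota 0 4].
(** The contractions of the bivector f ^ g with the four coordinate covectors:
    when f and g are independent, these points span the line f = g = 0. *)
Definition line_points (fg : seq cyc * seq cyc) : seq (seq cyc) :=
  let m := minor fg in
  [:: [:: cyc0; m 2 3; m 3 1; m 1 2]; [:: m 3 2; cyc0; m 0 3; m 2 0];
      [:: m 1 3; m 3 0; cyc0; m 0 1]; [:: m 2 1; m 0 2; m 1 0; cyc0]].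
Definition points_ok (fg : seq cyc * seq cyc) : bool :=
  all (fun v => cyc_eqb (cyc_dot fg.1 v) cyc0 && cyc_eqb (cyc_dot fg.2 v) cyc0)
      (line_points fg).
(** Some point of the first line is not on the second. *)
Definition line_differ (fg fg' : seq cyc * seq cyc) : bool :=
  has (fun v => cyc_nz (cyc_dot fg'.1 v) || cyc_nz (cyc_dot fg'.2 v)) (line_points fg).

Lemma lines_indep : all line_indep line_data. Proof. by vm_compute. Qed.
Lemma lines_points_ok : all points_ok line_data. Proof. by vm_compute. Qed.
Lemma lines_differ : pairwise line_differ line_data. Proof. by vm_compute. Qed.

(** On m0 = m1 = 0, where y2 and y3 are coordinates, any two of the l's are
    independent. *)
Definition l_pairs_indep_ok : bool :=
  all (fun ij => (ij.1 == ij.2) ||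
    cyc_nz (minor (lform ij.1, lform ij.2) 2 3)) [seq (i, j) | i <- iota 0 4, j <- iota 0 4].
Lemma l_pairs_indep : l_pairs_indep_ok. Proof. by vm_compute. Qed.

Lemma skew_pairs_cover : all (fun ij => (ij.1 == ij.2) || has (fun p => pair_l p == ij) skew_pairs)
  [seq (i, j) | i <- iota 0 4, j <- iota 0 4].
Proof. by vm_compute. Qed.

(** * Classification of the lines *)

Section PolynomialsOnLines.
Variable C : numFieldType.

Lemma poly_fun_eq0 (p : {poly C}) : (forall t, p.[t] = 0) -> p = 0.
Proof.
move=> p0; apply/eqP; apply: contraT => nz.
have := max_poly_roots nz (rs := [seq i%:R | i <- iota 0 (size p)]).
rewrite size_map size_iota ltnn => H; apply: H.
  by apply/allP => t _; apply/rootP.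
by rewrite map_inj_uniq ?iota_uniq //; apply: (mulrIn (oner_neq0 C)).
Qed.

End PolynomialsOnLines.

Lemma plane_basis (F : fieldType) (V : vectType F) (L : {vspace V}) :
  \dim L = 2%N ->
  exists a b : V, [/\ a \in L, b \in L,
    forall v, v \in L -> exists s t, v = s *: a + t *: b &
    forall s t, s *: a + t *: b = 0 -> s = 0 /\ t = 0].
Proof.
move=> dimL; have := vbasisP L; move: (vbasis L); rewrite dimL => X bX.
have memX i : X`_i \in L.
  have [hi|hi] := ltnP i (size X); first by rewrite (basis_mem bX) ?mem_nth.
  by rewrite nth_default // mem0v.
exists X`_0, X`_1; split=> // [v vL|s t st0].
  exists (coord X 0 v), (coord X (lift ord0 ord0) v).
  by rewrite {1}(coord_basis bX vL) !big_ord_recl big_ord0 addr0.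
have /freeP := basis_free bX.
move=> /(_ (fun i => if i == 0 then s else t)) fr.
have st : \sum_(i < 2) (if i == 0 then s else t) *: X`_i = 0.
  by rewrite !big_ord_recl big_ord0 addr0.
by split; [apply: (fr st 0) | apply: (fr st 1)].
Qed.

Section Lines.
Variables (C : numFieldType) (z : C).
Hypothesis z4 : z ^+ 4 = -1.
Local Notation lval := (lval z).
Local Notation qval := (qval z).
Local Notation V := 'rV[C]_4.
Implicit Types (f g : seq cyc) (fg : seq cyc * seq cyc) (u v : V).

Lemma lvalD f u v : lval f (u + v) = lval f u + lval f v.
Proof.
by rewrite /lval -big_split; apply: eq_bigr => k _; rewrite mxE mulrDr.
Qed.
Lemma lvalZ f c v : lval f (c *: v) = c * lval f v.
Proof.
by rewrite /lval mulr_sumr; apply: eq_bigr => k _; rewrite mxE mulrCA.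
Qed.
Lemma lval0 f : lval f 0 = 0.
Proof. by rewrite -(scale0r 0) lvalZ mul0r. Qed.

Lemma lval_lcomb c f d g v :
  lval (lcomb c f d g) v = ceval z c * lval f v + ceval z d * lval g v.
Proof.
rewrite /lval !mulr_sumr -big_split; apply: eq_bigr => k _ /=.
rewrite (nth_map 0%N) ?size_iota // nth_iota // add0n cevalD !(cevalM z4).
by rewrite mulrDl !mulrA.
Qed.

Lemma lval_eqb f g v : form_eqb f g -> lval f v = lval g v.
Proof.
move=> /allP fg; apply: eq_bigr => k _; congr (ceval z _ * _).
by apply/cyc_eqP/fg; rewrite mem_iota /=.
Qed.

Definition line_mx fg : 'M[C]_(4, 2) :=
  \matrix_(k, j) ceval z (nth cyc0 (if j == 0 then fg.1 else fg.2) k).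

Definition line_of fg : {vspace V} := lker (linfun (mulmxr (line_mx fg))).

Lemma line_ofP fg v :
  reflect (lval fg.1 v = 0 /\ lval fg.2 v = 0) (v \in line_of fg).
Proof.
rewrite memv_ker lfunE /=; apply: (iffP eqP) => [/rowP W0|[f0 g0]].
  split; [have := W0 0 | have := W0 1]; rewrite !mxE; apply: etrans;
    by apply: eq_bigr => k _; rewrite !mxE mulrC.
apply/rowP => j; rewrite !mxE; case: (eqVneq j 0) => [->|j0].
  by rewrite -[RHS]f0; apply: eq_bigr => k _; rewrite !mxE mulrC.
rewrite -[RHS]g0; apply: eq_bigr => k _; rewrite !mxE (negPf j0) mulrC //.
Qed.

Lemma dim_line_of fg : line_indep fg -> \dim (line_of fg) = 2%N.
Proof.
case/hasP => -[a b] /allpairsP[[a' b'] [ha hb [-> ->]]] {a b} nz.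
move: ha hb nz; rewrite !mem_iota /= => ha hb nz.
have : row_free (line_mx fg)^T.
  apply/inj_row_free => u uW.
  have eqn k : (k < 4)%N ->
      u 0 0 * ceval z (nth cyc0 fg.1 k) + u 0 1 * ceval z (nth cyc0 fg.2 k) = 0.
    move=> hk; have /rowP/(_ (Ordinal hk)) := uW.
    rewrite !mxE !big_ord_recl big_ord0 !mxE /= addr0 => e; rewrite -[RHS]e.
    by congr (_ + u 0 _ * _); apply: val_inj.
  have minor_val : ceval z (minor fg a' b') =
    ceval z (nth cyc0 fg.1 a') * ceval z (nth cyc0 fg.2 b') -
    ceval z (nth cyc0 fg.1 b') * ceval z (nth cyc0 fg.2 a').
    by rewrite cevalB !(cevalM z4).
  have nzC := ceval_neq0 z4 nz; rewrite minor_val in nzC.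
  have ea := eqn _ ha; have eb := eqn _ hb.
  apply/rowP => j; rewrite mxE; apply: (mulIf nzC); rewrite mul0r.
  move: ea eb; set fa := ceval z _; set ga := ceval z _; set fb := ceval z _.
  set gb := ceval z _ => ea eb.
  have [->|j1] : j = 0 \/ j = 1 by case: j => -[|[|//]] hj; [left|right]; apply: val_inj.
    have -> : u 0 0 * (fa * gb - fb * ga) =
      gb * (u 0 0 * fa + u 0 1 * ga) - ga * (u 0 0 * fb + u 0 1 * gb) by ring.
    by rewrite ea eb !mulr0 subrr.
  rewrite j1; have -> : u 0 1 * (fa * gb - fb * ga) =
      fa * (u 0 0 * fb + u 0 1 * gb) - fb * (u 0 0 * fa + u 0 1 * ga) by ring.
  by rewrite ea eb !mulr0 subrr.
case/row_freeP => B /(congr1 trmx); rewrite trmx_mul trmxK trmx1 => BW.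
have := limg_ker_dim (linfun (mulmxr (line_mx fg))) (fullv : {vspace V}).
rewrite capfv dimvf /dim /= -/(line_of fg).
have -> : (linfun (mulmxr (line_mx fg)) @: (fullv : {vspace V}))%VS = fullv.
  apply/eqP; rewrite eqEsubv subvf /=; apply/subvP => w _.
  apply/memv_imgP; exists (w *m B^T); first exact: memvf.
  by rewrite lfunE /= -mulmxA BW mulmx1.
by rewrite dimvf /dim /= !mul1n => /eqP; rewrite -[4%N]/(2 + 2)%N eqn_add2r => /eqP.
Qed.

Section Plane.
Variable L : {vspace V}.
Hypothesis dimL : \dim L = 2%N.

Definition vanishes f := forall v, v \in L -> lval f v = 0.

Lemma functional_root f : exists v, [/\ v \in L, v != 0 & lval f v = 0].
Proof.
have [a [b [aL bL _ fr]]] := plane_basis dimL.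
have [fa|fa] := eqVneq (lval f a) 0.
  exists a; split=> //; apply/eqP => a0.
  have [] := fr 1 0; first by rewrite a0 scaler0 scale0r addr0.
  by move/eqP; rewrite oner_eq0.
exists (lval f b *: a + (- lval f a) *: b); split.
- by rewrite rpredD ?rpredZ.
- by apply/eqP => /fr[_ /eqP]; rewrite oppr_eq0 (negPf fa).
- by rewrite lvalD !lvalZ mulNr mulrC subrr.
Qed.

(** A linear form that is not zero on the plane has a kernel of dimension 1
    there. *)
Lemma functional_kernel f u v : u \in L -> v \in L -> u != 0 ->
  lval f u = 0 -> lval f v = 0 -> ~ vanishes f -> exists k, v = k *: u.
Proof.
move=> uL vL u0 fu fv nf; have [a [b [aL bL span fr]]] := plane_basis dimL.
have [s [t eu]] := span _ uL; have [s' [t' ev]] := span _ vL.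
have := fu; have := fv; rewrite eu ev !lvalD !lvalZ.
set fa := lval f a; set fb := lval f b => fv' fu'.
have det0 : s * t' - s' * t = 0.
  have [fa0|fa0] := eqVneq fa 0.
    have fb0 : fb != 0.
      apply/eqP => fb0; apply: nf => w /span[x [y ->]].
      by rewrite lvalD !lvalZ -/fa -/fb fa0 fb0 !mulr0 addr0.
    apply: (mulIf fb0); rewrite mul0r.
    have -> : (s * t' - s' * t) * fb = s * (s' * fa + t' * fb) - s' * (s * fa + t * fb) by ring.
    by rewrite fv' fu' !mulr0 subrr.
  apply: (mulIf fa0); rewrite mul0r.
  have -> : (s * t' - s' * t) * fa = t' * (s * fa + t * fb) - t * (s' * fa + t' * fb) by ring.
  by rewrite fv' fu' !mulr0 subrr.
have [s0|s0] := eqVneq s 0.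
  have t0 : t != 0 by apply: contra_neq u0 => t0; rewrite eu s0 t0 !scale0r addr0.
  exists (t' / t); rewrite s0 scale0r add0r scalerA divfK //.
  have /eqP := det0; rewrite s0 mul0r sub0r oppr_eq0 mulf_eq0 (negPf t0) orbF.
  by move=> /eqP ->; rewrite scale0r add0r.
exists (s' / s); rewrite scalerDr !scalerA divfK //; congr (_ + _ *: _).
apply: (mulfI s0); rewrite mulrA mulrCA divff // mulr1.
by move/eqP: det0; rewrite subr_eq0 => /eqP.
Qed.

Lemma poly_along (fs : seq (seq cyc)) (a b : V) t :
  (\prod_(f <- fs) ((lval f a)%:P + (lval f b) *: 'X)).[t]
  = \prod_(f <- fs) lval f (a + t *: b).
Proof.
rewrite horner_prod; apply: eq_bigr => f _.
by rewrite !hornerE lvalD lvalZ mulrC.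
Qed.

(** Restricted to an affine line a + t b the product is a product of polynomials
    in t that vanishes identically. *)
Lemma product_vanishes (fs : seq (seq cyc)) :
  (forall v, v \in L -> \prod_(f <- fs) lval f v = 0) ->
  exists2 f, f \in fs & vanishes f.
Proof.
move=> prod0; have [a [b [aL bL span _]]] := plane_basis dimL.
have : \prod_(f <- fs) ((lval f a)%:P + lval f b *: 'X) = 0.
  by apply: poly_fun_eq0 => t; rewrite poly_along prod0 // rpredD ?rpredZ.
move/eqP; rewrite prodf_seq_eq0 => /hasP[f ffs] /= /eqP pf0.
exists f => // v /span[s [t ->]].
have fa : lval f a = 0.
  by have := congr1 (horner^~ 0) pf0; rewrite !hornerE ?mulr0 ?addr0.
have fb : lval f b = 0.
  by have := congr1 (horner^~ 1) pf0; rewrite !hornerE ?mulr1 fa add0r.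
by rewrite lvalD !lvalZ fa fb !mulr0 addr0.
Qed.
End Plane.

Lemma lval_sum4 f v : lval f v = ceval z (nth cyc0 f 0) * v 0 (ord4 0) +
  ceval z (nth cyc0 f 1) * v 0 (ord4 1) + ceval z (nth cyc0 f 2) * v 0 (ord4 2) +
  ceval z (nth cyc0 f 3) * v 0 (ord4 3).
Proof. by rewrite /lval sum_ord4. Qed.

(** l_i, l_j, m0, m1 form a coordinate system. *)
Lemma frame_neq0 i j v : (i < 4)%N -> (j < 4)%N -> i != j ->
  lval (mform 0) v = 0 -> lval (mform 1) v = 0 ->
  lval (lform i) v = 0 -> lval (lform j) v = 0 -> v = 0.
Proof.
move=> hi hj ij; rewrite (lval_sum4 (mform 0)) (lval_sum4 (mform 1)) [mform 0]/= [mform 1]/=.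
rewrite !(ceval0 z) !(ceval1 z) !mul0r !mul1r !add0r !addr0 => y0 y1.
rewrite !lval_sum4 y0 y1 !mulr0 !add0r.
have ij_in : (i, j) \in [seq (i, j) | i <- iota 0 4, j <- iota 0 4].
  by apply/allpairsP; exists (i, j); rewrite !mem_iota.
have /allP/(_ _ ij_in) := l_pairs_indep; rewrite [_ == _](negPf ij) orFb => nz.
have := ceval_neq0 z4 nz; rewrite cevalB !(cevalM z4) /=.
set p := ceval z _; set q := ceval z _; set p' := ceval z _; set q' := ceval z _.
set y2 : C := v 0 _; set y3 : C := v 0 _ => det0 e e'.
have y20 : y2 = 0.
  apply: (mulIf det0); rewrite mul0r.
  have -> : y2 * (p * q' - q * p') = q' * (p * y2 + q * y3) - q * (p' * y2 + q' * y3) by ring.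
  by rewrite e e' !mulr0 subrr.
have y30 : y3 = 0.
  apply: (mulIf det0); rewrite mul0r.
  have -> : y3 * (p * q' - q * p') = p * (p' * y2 + q' * y3) - p' * (p * y2 + q * y3) by ring.
  by rewrite e e' !mulr0 subrr.
apply/rowP => k; rewrite mxE.
by case: k => -[|[|[|[|//]]]] hk;
  [rewrite -[RHS]y0 | rewrite -[RHS]y1 | rewrite -[RHS]y20 | rewrite -[RHS]y30];
  congr (v 0 _); apply: val_inj.
Qed.

Section SkewPair.
Variable p : skew_pair.
Hypothesis p_ok : pair_ok p.
Local Notation li := (lform (pair_l p).1).
Local Notation lj := (lform (pair_l p).2).
Local Notation lk := (lform (pair_rest p).1).
Local Notation lh := (lform (pair_rest p).2).
Local Notation D := (ceval z (cyc_int (pair_den p))).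

Lemma prod_l_forms (R : comNzRingType) (F : seq cyc -> R) :
  \prod_(f <- l_forms) F f = F li * F lj * (F lk * F lh).
Proof.
move: p_ok; rewrite /pair_ok; case: (pair_l p) (pair_rest p) => i j [k h] /and5P[perm _ _ _ _].
have -> : \prod_(f <- l_forms) F f = \prod_(n <- iota 0 4) F (lform n).
  by rewrite -[in RHS](big_map lform xpredT F).
by rewrite -(perm_big _ perm) /= !big_cons big_nil mulr1 !mulrA.
Qed.

Lemma prod_m_forms (R : comNzRingType) (F : seq cyc -> R) :
  \prod_(f <- m_forms) F f = F (mform 0) * F (mform 1) * (F (mform 2) * F (mform 3)).
Proof. by rewrite !big_cons big_nil mulr1 !mulrA. Qed.

Lemma pair_rest_lt4 :
  [/\ ((pair_rest p).1 < 4)%N, (pair_l p).1 != (pair_rest p).1,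
      ((pair_rest p).2 < 4)%N & (pair_l p).1 != (pair_rest p).2].
Proof.
move: p_ok; rewrite /pair_ok; case: (pair_l p) (pair_rest p) => i j [k h].
case/and5P=> perm _ _ _ _.
have lt4 x : x \in [:: i; j; k; h] -> (x < 4)%N.
  by rewrite (perm_mem perm) mem_iota.
have := iota_uniq 0 4; rewrite -(perm_uniq perm) /= !inE !negb_or.
case/and4P=> /and3P[ij ik ih] _ _ _.
by rewrite !lt4 ?inE ?eqxx ?orbT.
Qed.

Let lam k c := ceval z (nth cyc0 (nth nil (pair_frame p) k) c).

Lemma frame_eval k v : (k < 4)%N ->
  2 * lval (nth nil [:: lk; lh; mform 2; mform 3] k) v =
  lam k 0 * lval li v + lam k 1 * lval lj v +
  (lam k 2 * lval (mform 0) v + lam k 3 * lval (mform 1) v).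
Proof.
move=> hk; have : frame_ok p.
  by move: p_ok; rewrite /pair_ok; case: (pair_l p) (pair_rest p) => i j [k' h] /and5P[_ _ _ -> _].
move=> /allP/(_ k); rewrite mem_iota => /(_ hk) /(lval_eqb v).
rewrite !lval_lcomb !(ceval0 z) !(ceval1 z) mul0r addr0 !mul1r => <-.
by rewrite (ceval_int z).
Qed.

(** The restriction of F to the line m0 = (be / D) l_i, m1 = (al / D) l_j.  Both
    l_i l_j = x y and D^2 m0 m1 = al be x y contain the factor x y. *)
Lemma residual v al be :
  D * lval (mform 0) v = be * lval li v -> D * lval (mform 1) v = al * lval lj v ->
  let E k := peval z [:: al; be] (nth PEO (line_eqs p) k) in
  let x := lval lj v in let y := lval li v in
  4 * D ^+ 4 * qval v = x * y * (E 0%N * x ^+ 2 + E 1%N * (x * y) + E 2 * y ^+ 2).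
Proof.
move=> e0 e1 E x y.
pose X k := D * lam k 1 + lam k 3 * al; pose Y k := D * lam k 0 + lam k 2 * be.
have xE k : peval z [:: al; be] (xpart p k (X_ 0)) = X k.
  by rewrite -[LHS]/(ceval z _ + _ * _) cevalM.
have yE k : peval z [:: al; be] (ypart p k (X_ 1)) = Y k.
  by rewrite -[LHS]/(ceval z _ + _ * _) cevalM.
pose comb a b c d := D * D * (a * b) + al * be * (c * d).
have E0 : E 0%N = comb (X 0%N) (X 1%N) (X 2) (X 3).
  by rewrite /comb -!xE -(cevalM z4).
have E1 : E 1%N = comb (X 0%N) (Y 1%N) (X 2) (Y 3) + comb (Y 0%N) (X 1%N) (Y 2) (X 3).
  by rewrite /comb -!xE -!yE -(cevalM z4).
have E2 : E 2 = comb (Y 0%N) (Y 1%N) (Y 2) (Y 3).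
  by rewrite /comb -!yE -(cevalM z4).
have part k : (k < 4)%N ->
    D * (2 * lval (nth nil [:: lk; lh; mform 2; mform 3] k) v) = X k * x + Y k * y.
  move=> hk; rewrite (frame_eval _ hk) !mulrDr.
  have -> : D * (lam k 2 * lval (mform 0) v) = lam k 2 * (D * lval (mform 0) v) by ring.
  have -> : D * (lam k 3 * lval (mform 1) v) = lam k 3 * (D * lval (mform 1) v) by ring.
  by rewrite e0 e1 /X /Y -/x -/y; ring.
have := part 0%N isT; have := part 1%N isT; have := part 2 isT; have := part 3 isT.
rewrite /qval prod_l_forms prod_m_forms [nth _ _ 0]/= [nth _ _ 1]/= [nth _ _ 2]/= [nth _ _ 3]/=.
rewrite -/x -/y => p3 p2 p1 p0.
have -> : 4 * D ^+ 4 * (y * x * (lval lk v * lval lh v) +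
    lval (mform 0) v * lval (mform 1) v * (lval (mform 2) v * lval (mform 3) v)) =
  D ^+ 2 * (y * x) * (D * (2 * lval lk v)) * (D * (2 * lval lh v)) +
  (D * lval (mform 0) v) * (D * lval (mform 1) v) *
  ((D * (2 * lval (mform 2) v)) * (D * (2 * lval (mform 3) v))) by ring.
rewrite p0 p1 p2 p3 e0 e1 -/x -/y E0 E1 E2 /comb; ring.
Qed.

(** The certificate gives alpha, then the first equation gives beta. *)
Lemma pair_solve al be : al != 0 -> be != 0 ->
  (forall k, (k < 3)%N -> peval z [:: al; be] (nth PEO (line_eqs p) k) = 0) ->
  exists2 s, s \in pair_sols p & al = ceval z s.1 /\ be = ceval z s.2.
Proof.
move=> al0 be0 E0.
have [scale_nz roots sols] : [/\ cyc_nz (cyc_int (root_scale p)), roots_ok p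
    & all (sol_ok p) (pair_sols p)].
  by move: p_ok; rewrite /pair_ok; case: (pair_l p) (pair_rest p) => i j [k' h]
    /and5P[_ _ nz _ /andP[]].
have := ideal_member (env := [:: al; be]) z4 roots E0.
set m := mono2_expr _; set prd := pprod _.
have -> : peval z [:: al; be] (PEmul (PEmul (PEc (cyc_int (root_scale p))) m) prd) =
  ceval z (cyc_int (root_scale p)) * peval z [:: al; be] m * peval z [:: al; be] prd by [].
have m0 : peval z [:: al; be] m != 0.
  rewrite -[peval z _ m]/(ceval z cyc1 *
    (al ^+ N.to_nat (N.of_nat _) * be ^+ N.to_nat (N.of_nat _))).
  by rewrite (ceval1 z) mul1r mulf_neq0 ?expf_neq0.
move/eqP; rewrite mulf_eq0 mulf_eq0 (negPf (ceval_neq0 z4 scale_nz)) (negPf m0) /=.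
rewrite peval_prod big_map prodf_seq_eq0 => /hasP[s ssol] /= /eqP root_s.
have al_s : al = ceval z s.1.
  by apply/eqP; rewrite -subr_eq0; apply/eqP; exact: root_s.
exists s => //; split=> //; have /allP/(_ s ssol)/and3P[v0 lin_s _] := sols.
have := E0 0%N isT.
have -> : [:: al; be] = map (peval z [:: al; be]) [:: PEc s.1; X_ 1].
  by rewrite /= al_s.
rewrite -peval_subst (same_polyP z4 _ lin_s).
set w := cyc_mul _ _ in v0 *.
have -> : peval z [:: al; be] (PEmul (PEc w) (PEsub (X_ 1) (PEc s.2))) =
  ceval z w * (be - ceval z s.2) by [].
by move/eqP; rewrite mulf_eq0 (negPf (ceval_neq0 z4 v0)) subr_eq0 => /eqP.
Qed.

Lemma pair_line_vanishes s v : s \in pair_sols p -> v \in line_of (pair_line p s) ->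
  qval v = 0.
Proof.
move=> ssol /line_ofP[]; rewrite !lval_lcomb !(cevalN z) !mulNr.
move=> /eqP; rewrite subr_eq0 => /eqP e0 /eqP; rewrite subr_eq0 => /eqP e1.
have [D0 sols] : cyc_nz (cyc_int (pair_den p)) /\ all (sol_ok p) (pair_sols p).
  by move: p_ok; rewrite /pair_ok; case: (pair_l p) (pair_rest p) => i j [k' h]
    /and5P[_ D0 _ _ /andP[]].
have D4 : 4 * D ^+ 4 != 0.
  by rewrite mulf_neq0 ?pnatr_eq0 // expf_neq0 // ceval_neq0.
have := residual e0 e1; cbv beta zeta.
have /allP/(_ s ssol)/and3P[_ _ sub0] := sols.
have Ek k : (k < 3)%N ->
    peval z [:: ceval z s.1; ceval z s.2] (nth PEO (line_eqs p) k) = 0.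
  move=> hk; rewrite (_ : [:: ceval z s.1; ceval z s.2] =
    map (peval z nil) [:: PEc s.1; PEc s.2]) // -peval_subst.
  by rewrite (same_polyP z4 _ (elimT (all_nthP PEO) sub0 k hk)).
rewrite !Ek // !mul0r !addr0 mulr0 => /eqP.
by rewrite mulf_eq0 (negPf D4) => /eqP.
Qed.
End SkewPair.

Definition skew_pair0 := SkewPair (0, 0)%N (0, 0)%N 0 nil nil (0, 0)%N 0 nil.

Lemma nth_pair_ok n : (n < size skew_pairs)%N -> pair_ok (nth skew_pair0 skew_pairs n).
Proof. exact: (elimT (all_nthP skew_pair0) pairs_ok). Qed.

Lemma line_data_vanishes fg v : fg \in line_data -> v \in line_of fg -> qval v = 0.
Proof.
rewrite mem_cat => /orP[/allpairsP[[f g] [/= fl gm ->]] /line_ofP[/= fv gv]|].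
  by rewrite /qval (big_rem f fl) (big_rem g gm) /= fv gv !mul0r addr0.
case/flattenP => ls /(nthP nil)[n]; rewrite size_map => hn.
rewrite (nth_map skew_pair0) // => <- /mapP[s ssol ->].
exact: (@pair_line_vanishes _ (nth_pair_ok hn) _ v ssol).
Qed.

Section Classification.
Variable L : {vspace V}.
Hypotheses (dimL : \dim L = 2%N) (LQ : forall v, v \in L -> qval v = 0).
Local Notation vanishes := (vanishes L).
Local Notation known := (exists2 fg, fg \in line_data & L = line_of fg).

Lemma known_line fg : fg \in line_data -> vanishes fg.1 -> vanishes fg.2 -> known.
Proof.
move=> fgd v1 v2; exists fg => //; apply/eqP.
rewrite eqEdim dim_line_of ?(allP lines_indep) // dimL leqnn andbT.
by apply/subvP => v vL; apply/line_ofP; split; [exact: v1 | exact: v2].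
Qed.

Lemma plane_line f : f \in l_forms ++ m_forms -> vanishes f -> known.
Proof.
rewrite mem_cat => /orP[fl|fm] f0.
  have [g gm g0] : exists2 g, g \in m_forms & vanishes g.
    apply: (product_vanishes dimL) => v vL; have := LQ vL.
    by rewrite /qval (big_rem f fl) /= f0 // mul0r add0r.
  apply: (@known_line (f, g)) => //; rewrite mem_cat; apply/orP; left.
  by apply/allpairsP; exists (f, g).
have [g gl g0] : exists2 g, g \in l_forms & vanishes g.
  apply: (product_vanishes dimL) => v vL; have := LQ vL.
  by rewrite /qval (big_rem f fm) /= f0 // mul0r addr0.
apply: (@known_line (g, f)) => //; rewrite mem_cat; apply/orP; left.
by apply/allpairsP; exists (g, f).
Qed.

Lemma cover_pair i j : (i < 4)%N -> (j < 4)%N -> i != j ->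
  exists2 n, (n < size skew_pairs)%N & pair_l (nth skew_pair0 skew_pairs n) = (i, j).
Proof.
move=> hi hj ij.
have ij_in : (i, j) \in [seq (i, j) | i <- iota 0 4, j <- iota 0 4].
  by apply/allpairsP; exists (i, j); rewrite !mem_iota.
have /allP/(_ _ ij_in) := skew_pairs_cover; rewrite [_ == _](negPf ij) orFb.
by case/(has_nthP skew_pair0) => n hn /eqP; exists n.
Qed.

(** When l_i, m0, m1 all vanish at [A], the second product of F vanishes to order
    2 at [A], the first one to order 1 with differential a nonzero multiple of
    l_i: the tangent plane at [A] is l_i = 0, and it contains every line of the
    surface through [A]. *)
Lemma tangent_vanishes i A : (i < 4)%N -> A \in L -> A != 0 ->
  lval (mform 0) A = 0 -> lval (mform 1) A = 0 -> lval (lform i) A = 0 ->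
  vanishes (lform i).
Proof.
move=> hi AL A0 m0 m1 l0 v vL.
have [j [hj ij]] : exists j, (j < 4)%N /\ i != j.
  by exists (i == 0)%N; case: (i) => [|[|]].
have [n hn pl] := cover_pair hi hj ij.
have ok := nth_pair_ok hn; set p := nth _ _ _ in pl ok.
have neq0 j' : (j' < 4)%N -> i != j' -> lval (lform j') A != 0.
  by move=> hj' ij'; apply: contra_neq A0; apply: frame_neq0 hi hj' ij' m0 m1 l0.
pose pf f := (lval f A)%:P + lval f v *: 'X.
have pf_zero f : lval f A = 0 -> pf f = lval f v *: 'X.
  by rewrite /pf => ->; rewrite add0r.
(* the restriction of F to A + t v, as a polynomial in t *)
have : \prod_(f <- l_forms) pf f + \prod_(f <- m_forms) pf f = 0.
  apply: poly_fun_eq0 => t; rewrite hornerD !poly_along.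
  by apply: LQ; rewrite rpredD ?rpredZ.
rewrite (prod_l_forms ok) (prod_m_forms pf) pl /=.
rewrite (pf_zero _ l0) (pf_zero _ m0) (pf_zero _ m1).
have [] := pair_rest_lt4 ok; rewrite -/p pl /= => hk ik hh ih.
set lk := lform (pair_rest p).1; set lh := lform (pair_rest p).2 => e.
have : 'X * (lval (lform i) v *: (pf (lform j) * (pf lk * pf lh)) +
    (lval (mform 0) v * lval (mform 1) v) *: ('X * (pf (mform 2) * pf (mform 3)))) = 0.
  rewrite -[RHS]e -!mul_polyC polyCM; ring.
move/eqP; rewrite mulf_eq0 polyX_eq0 /= => /eqP /(congr1 (horner^~ 0)).
have pf0 f : (pf f).[0] = lval f A by rewrite /pf !hornerE ?mulr0 ?addr0.
rewrite hornerD !hornerZ !hornerM hornerX !pf0 horner0 !mul0r mulr0 addr0 => /eqP.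
by rewrite !mulf_eq0 !(negPf (neq0 _ _ _)) // !orbF => /eqP.
Qed.

(** With A, B on the planes m0 = 0, m1 = 0 as above.  For i <> j the points A and B
    are distinct since four coordinates would vanish at a common point; so a
    form vanishing at both vanishes on the line, and l_j(A), m1(A), l_i(B),
    m0(B) are nonzero.  After rescaling, l_j(A) = l_i(B) = 1. *)
Lemma line_classification : known.
Proof.
case: (pselect (exists2 f, f \in l_forms ++ m_forms & vanishes f)) => [[f fin f0]|nv].
  exact: plane_line fin f0.
have nvl i : (i < 4)%N -> ~ vanishes (lform i).
  by move=> hi f0; apply: nv; exists (lform i) => //; rewrite mem_cat mem_nth.
have nvm i : (i < 4)%N -> ~ vanishes (mform i).
  by move=> hi f0; apply: nv; exists (mform i) => //; rewrite mem_cat mem_nth ?orbT.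
have meet k : (k < 4)%N -> exists A i, [/\ A \in L, A != 0, lval (mform k) A = 0,
    (i < 4)%N & lval (lform i) A = 0].
  move=> hk; have [A [AL A0 mA]] := functional_root dimL (mform k).
  have mk : mform k \in m_forms by rewrite mem_nth.
  have := LQ AL; rewrite /qval (big_rem _ mk) /= mA mul0r addr0 => /eqP.
  rewrite prodf_seq_eq0 => /hasP[f /(nthP nil)[i hi <-]] /= /eqP fA.
  by exists A, i.
have [A [i [AL A0 m0A hi liA]]] := meet 0%N isT.
have [B [j [BL B0 m1B hj ljB]]] := meet 1%N isT.
have [eij|ij] := eqVneq i j.
  subst j; have [m1A|m1A] := eqVneq (lval (mform 1) A) 0.
    by case: (nvl i hi); apply: tangent_vanishes hi AL A0 m0A m1A liA.
  have [k eB] := functional_kernel dimL AL BL A0 liA ljB (nvl i hi).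
  move: m1B B0; rewrite eB lvalZ => /eqP; rewrite mulf_eq0 (negPf m1A) orbF => /eqP ->.
  by rewrite scale0r eqxx.
have indep k : B <> k *: A.
  move=> eB; have k0 : k != 0 by apply: contra_neq B0 => k0; rewrite eB k0 scale0r.
  case/eqP: A0; apply: (frame_neq0 hi hj ij m0A _ liA).
    by move/eqP: m1B; rewrite eB lvalZ mulf_eq0 (negPf k0) => /eqP.
  by move/eqP: ljB; rewrite eB lvalZ mulf_eq0 (negPf k0) => /eqP.
have span_vanishes f : lval f A = 0 -> lval f B = 0 -> vanishes f.
  move=> fA fB; apply: contrapT => nf.
  by have [k /indep] := functional_kernel dimL AL BL A0 fA fB nf.
have ljA : lval (lform j) A != 0.
  by apply/eqP => ljA; apply: (nvl j hj); apply: span_vanishes.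
have m1A : lval (mform 1) A != 0.
  by apply/eqP => m1A; apply: (nvm 1%N isT); apply: span_vanishes.
have liB : lval (lform i) B != 0.
  by apply/eqP => liB; apply: (nvl i hi); apply: span_vanishes.
have m0B : lval (mform 0) B != 0.
  by apply/eqP => m0B; apply: (nvm 0%N isT); apply: span_vanishes.
have [n hn pl] := cover_pair hi hj ij.
have ok := nth_pair_ok hn; set p := nth _ _ _ in pl ok.
have [pl1 pl2] : (pair_l p).1 = i /\ (pair_l p).2 = j by rewrite pl.
set D := ceval z (cyc_int (pair_den p)).
have D0 : D != 0.
  apply: (ceval_neq0 z4); move: ok; rewrite /pair_ok.
  by case: (pair_l p) (pair_rest p) => i' j' [k' h'] /and5P[].
pose A1 := (lval (lform j) A)^-1 *: A; pose B1 := (lval (lform i) B)^-1 *: B.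
pose al := D * lval (mform 1) A1; pose be := D * lval (mform 0) B1.
have al0 : al != 0 by rewrite mulf_neq0 // lvalZ mulf_neq0 // invr_eq0.
have be0 : be != 0 by rewrite mulf_neq0 // lvalZ mulf_neq0 // invr_eq0.
have ljA1 : lval (lform j) A1 = 1 by rewrite lvalZ mulVf.
have liB1 : lval (lform i) B1 = 1 by rewrite lvalZ mulVf.
have liA1 : lval (lform i) A1 = 0 by rewrite lvalZ liA mulr0.
have ljB1 : lval (lform j) B1 = 0 by rewrite lvalZ ljB mulr0.
have m0A1 : lval (mform 0) A1 = 0 by rewrite lvalZ m0A mulr0.
have m1B1 : lval (mform 1) B1 = 0 by rewrite lvalZ m1B mulr0.
have eA : A = lval (lform j) A *: A1 by rewrite scalerA divff // scale1r.
have eB : B = lval (lform i) B *: B1 by rewrite scalerA divff // scale1r.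
have A1L : A1 \in L by rewrite rpredZ.
have B1L : B1 \in L by rewrite rpredZ.
clearbody A1 B1.
pose E k := peval z [:: al; be] (nth PEO (line_eqs p) k).
have Exy x y : x != 0 -> y != 0 -> E 0%N * x ^+ 2 + E 1%N * (x * y) + E 2 * y ^+ 2 = 0.
  move=> x0 y0; pose v := x *: A1 + y *: B1.
  have vL : v \in L by rewrite rpredD ?rpredZ.
  have liv : lval (lform i) v = y by rewrite lvalD !lvalZ liA1 liB1 mulr0 mulr1 add0r.
  have ljv : lval (lform j) v = x by rewrite lvalD !lvalZ ljA1 ljB1 mulr0 mulr1 addr0.
  have e0 : D * lval (mform 0) v = be * lval (lform (pair_l p).1) v.
    by rewrite pl1 liv lvalD !lvalZ m0A1 mulr0 add0r /be mulrCA mulrC.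
  have e1 : D * lval (mform 1) v = al * lval (lform (pair_l p).2) v.
    by rewrite pl2 ljv lvalD !lvalZ m1B1 mulr0 addr0 /al mulrCA mulrC.
  have := residual ok e0 e1; cbv beta zeta; rewrite LQ // mulr0 pl1 pl2 liv ljv.
  by move/esym/eqP; rewrite !mulf_eq0 (negPf x0) (negPf y0) => /eqP.
(* three values of (x, y) off x y = 0 determine the three coefficients *)
have two0 : (2 : C) != 0 by rewrite pnatr_eq0.
have three0 : (3 : C) != 0 by rewrite pnatr_eq0.
have n10 : (-1 : C) != 0 by rewrite oppr_eq0 oner_eq0.
have F1 := Exy 1 1 (oner_neq0 C) (oner_neq0 C).
have F2 := Exy 1 (-1) (oner_neq0 C) n10.
have F3 := Exy 2 1 two0 (oner_neq0 C).
have E10 : E 1%N = 0.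
  apply: (mulfI two0); rewrite mulr0; apply: etrans (_ : _ = 0 - 0) _; last by rewrite subr0.
  by rewrite -{1}F1 -F2; ring.
have E00 : E 0%N = 0.
  apply: (mulfI three0); rewrite mulr0; apply: etrans (_ : _ = 0 - 0) _; last by rewrite subr0.
  by rewrite -{1}F3 -F1 E10; ring.
have E20 : E 2 = 0 by move: F1; rewrite E10 E00 !mul0r !add0r expr1n mulr1.
have [|s ssol [als bes]] := pair_solve ok al0 be0.
  by case=> [|[|[|]]].
apply: (@known_line (pair_line p s)).
- rewrite mem_cat; apply/orP; right; apply/flattenP.
  exists [seq pair_line p s | s <- pair_sols p]; last exact: map_f.
  apply/(nthP nil); exists n; rewrite ?size_map //.
  by rewrite (nth_map skew_pair0).
- apply: span_vanishes; rewrite lval_lcomb (cevalN z) -bes pl1 -/D.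
    by rewrite m0A liA !mulr0 addr0.
  by rewrite eB !lvalZ liB1 /be; ring.
- apply: span_vanishes; rewrite lval_lcomb (cevalN z) -als pl2 -/D.
    by rewrite eA !lvalZ ljA1 /al; ring.
  by rewrite m1B ljB !mulr0 addr0.
Qed.

End Classification.

End Lines.

(** * Number of lines and conclusion *)

Lemma card_set_seq_uniq (T : eqType) (s : seq T) n : uniq s -> size s = n ->
  [set` s] #= `I_n.
Proof.
case: s => [|x0 s] us <-; first by rewrite set_nil II0 card_eq00.
set s' := x0 :: s in us *.
have -> : [set` s'] = nth x0 s' @` `I_(size s').
  rewrite eqEsubset; split=> [x /= /(nthP x0)[i hi <-]|x [i hi <-]] /=.
    by exists i.
  exact: mem_nth.
apply: inj_card_eq => i j /set_mem hi /set_mem hj /eqP.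
by rewrite nth_uniq // => /eqP.
Qed.

Section Counting.
Variables (C : numFieldType) (z : C).
Hypothesis z4 : z ^+ 4 = -1.

Lemma lval_point f v :
  lval z f (\row_k ceval z (nth cyc0 v k)) = ceval z (cyc_dot f v).
Proof.
rewrite lval_sum4 !mxE /cyc_dot /= !(cevalD z) !(cevalM z4) (ceval0 z).
by rewrite addr0 !addrA.
Qed.

Lemma line_of_neq fg fg' : points_ok fg -> line_differ fg fg' ->
  line_of z fg != line_of z fg'.
Proof.
move=> /allP ok /hasP[v vin nz]; apply/eqP => e.
have /andP[/cyc_eqP f0 /cyc_eqP g0] := ok v vin.
have : \row_k ceval z (nth cyc0 v k) \in line_of z fg.
  by apply/line_ofP; rewrite !lval_point f0 g0 (ceval0 z).
rewrite e => /line_ofP[]; rewrite !lval_point => /eqP f0' /eqP g0'.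
by case/orP: nz => /(ceval_neq0 z4); rewrite ?f0' ?g0'.
Qed.

Lemma lines_uniq : uniq [seq line_of z fg | fg <- line_data].
Proof.
rewrite uniq_pairwise pairwise_map.
apply: (sub_in_pairwise (P := points_ok)) lines_points_ok lines_differ.
by move=> fg fg' ok _ df /=; apply: line_of_neq.
Qed.

Lemma lines_in_quartic :
  lines_in (surface (quartic z)) = [set` [seq line_of z fg | fg <- line_data]].
Proof.
rewrite eqEsubset; split=> L.
  move=> [dimL LX].
  have [v vL|fg fgd ->] := line_classification z4 dimL _; last first.
    exact: (map_f (line_of z) fgd).
  have [->|v0] := eqVneq v 0.
    by rewrite /qval !big_cons !(lval0 z) !mul0r addr0.
  rewrite -quartic_eval; apply/eqP; rewrite (dhomog_root v0 (quartic_homog z)).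
  by apply/eqP; apply: (LX (pt_of v0)) => //; apply: pt_of_mem.
move=> /mapP[fg fgd ->]; split.
  by rewrite dim_line_of ?(allP lines_indep).
move=> p; rewrite val_ppoint -memvE => pL f ->.
by rewrite coordsE quartic_eval (line_data_vanishes z4 fgd).
Qed.

Lemma quartic_lines_card : lines_in (surface (quartic z)) #= `I_56.
Proof.
rewrite lines_in_quartic; apply: card_set_seq_uniq lines_uniq _.
by rewrite size_map size_line_data.
Qed.

Lemma isomorphism_X48 : isomorphism (Sci z) (X48 C) fst.
Proof.
rewrite /Sci QsE.
exact: determinantal_isomorphism (det_scale_neq0 z4) (det_tensor z4) (@fermat_smooth C).
Qed.

Lemma isomorphism_quartic : isomorphism (Sci z) (surface (quartic z)) snd.
Proof.
rewrite /Sci QsE.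
exact: determinantal_isomorphism_snd (det_scale_neq0 z4) (det_tensor_tr z4) (quartic_smooth z4).
Qed.

Lemma Sci_smooth : @smooth_complete_intersection C (projProd C 3 3) 4 (Qs z).
Proof.
rewrite QsE.
exact: determinantal_smooth_ci (det_scale_neq0 z4) (det_tensor z4) (@fermat_smooth C) (X48_neq0 z4).
Qed.

Lemma quartic_smooth_quartic : smooth_quartic (quartic z).
Proof.
split; first exact: quartic_homog.
have [_ [p Sp] _] := Sci_smooth.
have [[toX _ _] _] := isomorphism_quartic.
split.
- by move=> i; exists 4%N; rewrite (ord1 i) /=; apply: quartic_homog.
- by exists p.2 => f; rewrite /= inE => /eqP ->; apply: (toX p Sp).
- move=> q Fq; apply/eqP; rewrite -/(row_free _); apply/inj_row_free => u u0.
  have Fq0 : (quartic z).@[pvec q 0] = 0 by apply: Fq; rewrite /= inE.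
  have [k nz] := quartic_smooth z4 (pvec_neq0 q) Fq0.
  apply/rowP => i; rewrite (ord1 i) mxE; apply: (mulIf nz); rewrite mul0r.
  have /rowP/(_ k) := u0; rewrite !mxE big_ord1 mxE /=.
  exact.
Qed.

(** The isomorphism with the Fermat quartic is the composite of the two
    projections of S. *)
Lemma quartic_is_X56 : is_X56 (quartic z).
Proof.
split; [exact: quartic_smooth_quartic | exact: quartic_lines_card |].
exact: isomorphism_isomorphic isomorphism_quartic isomorphism_X48.
Qed.

End Counting.

Theorem mainTheorem6 (R : realType) (z : R[i]) (hz : 8.-primitive_root z) :
  @smooth_complete_intersection R[i] (projProd R[i] 3 3) 4 (Qs z) /\
  isomorphism (Sci z) (X48 R[i]) fst /\
  exists F : {mpoly R[i][4]},
    is_X56 F /\ isomorphism (Sci z) (surface F) snd.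
Proof.
have z4 : z ^+ 4 = -1.
  have /eqP := prim_expr_order hz.
  rewrite (_ : 8 = 4 * 2)%N // exprM sqrf_eq1 -(prim_order_dvd hz) /=.
  by move/eqP.
split; first exact: Sci_smooth.
split; first exact: isomorphism_X48.
exists (quartic z); split; first exact: quartic_is_X56.
exact: isomorphism_quartic.
Qed.
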